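(* Let $k \geq 3$ be an integer, let $C_{4,k}$ be the $k$-uniform hypercycle with length four, and let $\mathcal{A}_{C_{4,k}}$ be its adjacency tensor. Then the $2k$-th order trace of $\mathcal{A}_{C_{4,k}}$ is $$\mathrm{Tr}_{2k}(\mathcal{A}_{C_{4,k}})=4k^{k-1}(k-1)^{3k-4}+8k^{2k-3}(k-1)^{2k-3}.$$
   Context: A $k$-uniform hypergraph $H=(V,E)$ is a finite vertex set $V$ together with a set $E$ of $k$-element subsets of $V$ (edges). The $k$-uniform hypercycle with length $m$, $C_{m,k}$, has vertices $v_1,v_2,\ldots,v_{m(k-1)+1}$ with $v_1=v_{m(k-1)+1}$ identified (and no other identifications), and edges $e_i=\{v_{(i-1)(k-1)+1},v_{(i-1)(k-1)+2},\ldots,v_{i(k-1)+1}\}$ for $i=1,\ldots,m$; equivalently it is obtained from the cycle graph of length $m$ by adding $k-2$ new vertices to every edge. Thus $C_{4,k}$ has $n=4(k-1)$ vertices and $4$ edges. The adjacency tensor of a $k$-uniform hypergraph $H$ on $n$ vertices (labelled $1,\ldots,n$) is the $k$-order $n$-dimensional tensor $\mathcal{A}_H=(a_{i_1i_2\ldots i_k})$ with $a_{i_1\ldots i_k}=\frac{1}{(k-1)!}$ if $\{i_1,\ldots,i_k\}\in E$ and $0$ otherwise. For a $k$-order $n$-dimensional tensor $\mathcal{T}=(t_{i_1\ldots i_k})$ over $\mathbb{C}$, the $j$-th order trace is $$\mathrm{Tr}_{j}(\mathcal{T})=(k-1)^{n-1}\sum_{j_{1}+\cdots+j_{n}=j}\Big[\prod_{i=1}^{n}\frac{1}{(j_{i}(k-1))!}\Big(\sum_{l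 \in [n]^{k-1}}t_{il}\frac{\partial}{\partial x_{il}}\Big)^{j_{i}}\Big] \mathrm{tr}(X^{j(k-1)}),$$ where $X=(x_{ij})$ is an $n\times n$ matrix of independent variables, $[n]=\{1,\ldots,n\}$, for $l=l_2\cdots l_k$ one writes $t_{il}=t_{il_2\ldots l_k}$ and $\frac{\partial}{\partial x_{il}}=\frac{\partial}{\partial x_{il_2}}\cdots\frac{\partial}{\partial x_{il_k}}$, and $j_1,\ldots,j_n$ run over all nonnegative integers with sum $j$. *)

(* Defs.v *)
From mathcomp Require Import all_boot all_order all_algebra.
From mathcomp Require Export mpoly.

Set Implicit Arguments.
Unset Strict Implicit.
Unset Printing Implicit Defensive.

Import GRing.Theory.
Local Open Scope ring_scope.

(* A hypergraph on the labelled vertex set 'I_n is its set of edges. *)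
Definition hypergraph (n : nat) := {set {set 'I_n}}.

Definition kuniform (k n : nat) (H : hypergraph n) : Prop :=
  forall e, e \in H -> #|e| = k.

(* The vertex v_(j+1) is represented by the residue of j modulo m(k-1), which
   performs the identification of v_(m(k-1)+1) with v_1; [i] stands for the
   edge e_(i+1). *)
Definition hypercycle_edge (m k : nat) (i : 'I_m) : {set 'I_(m * k.-1)} :=
  [set v : 'I_(m * k.-1) |
     [exists t : 'I_k, v == ((i * k.-1 + t) %% (m * k.-1))%N :> nat]].

Definition hypercycle (m k : nat) : hypergraph (m * k.-1) :=
  [set hypercycle_edge k i | i : 'I_m].

Lemma hypercycle_uniform (m k : nat) :
  (1 < m)%N -> (1 < k)%N -> kuniform k (hypercycle m k).
Proof.
move=> m_gt1 k_gt1 _ /imsetP[i _ ->].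
have k1_gt0 : (0 < k.-1)%N by rewrite -subn1 subn_gt0.
have N_gt0 : (0 < m * k.-1)%N by rewrite muln_gt0 k1_gt0 ltnW.
have le_kN : (k <= m * k.-1)%N.
  apply: (@leq_trans (2 * k.-1)%N); last by rewrite leq_mul2r m_gt1 orbT.
  by rewrite mul2n -addnn -{1}(prednK (ltnW k_gt1)) -addn1 leq_add2l.
pose f (t : 'I_k) : 'I_(m * k.-1) :=
  Ordinal (ltn_pmod (i * k.-1 + t) N_gt0).
have f_inj : injective f.
  move=> s t /(congr1 val) /= /eqP; rewrite eqn_modDl.
  rewrite !modn_small ?(leq_trans (ltn_ord _)) // => /eqP.
  exact: val_inj.
suff -> : hypercycle_edge k i = [set f t | t : 'I_k].
  by rewrite card_imset // card_ord.
apply/setP=> v; rewrite inE; apply/existsP/imsetP=> [[t /eqP vt]|[t _ ->]].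
  by exists t => //; apply: val_inj.
by exists t.
Qed.

(* Tensors of order k (k >= 1) and dimension n, the first index being kept
   apart from the remaining k-1: [T i l] is t_(il) with l in [n]^(k-1). *)
Definition tensor (F : Type) (k n : nat) := 'I_n -> k.-1.-tuple 'I_n -> F.

Definition adjacency_tensor (F : fieldType) (k n : nat) (H : hypergraph n) :
    tensor F k n :=
  fun i l => if [set x in i :: l] \in H then ((k.-1)`!%:R)^-1 else 0.

Arguments adjacency_tensor F k {n} H i l.

(* The n^2 independent variables x_(ij) are numbered through [mxvec_index]. *)
Definition generic_mx (F : fieldType) (n : nat) : 'M[{mpoly F[n * n]}]_n :=
  \matrix_(i, j) 'X_(mxvec_index i j).

Definition partial_tuple (F : fieldType) (k n : nat) (i : 'I_n)
    (l : k.-1.-tuple 'I_n) (p : {mpoly F[n * n]}) : {mpoly F[n * n]} :=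
  foldr (fun s q => mderiv (mxvec_index i s) q) p l.

Definition tensor_diffop (F : fieldType) (k n : nat) (T : tensor F k n)
    (i : 'I_n) (p : {mpoly F[n * n]}) : {mpoly F[n * n]} :=
  \sum_(l : k.-1.-tuple 'I_n) T i l *: partial_tuple i l p.

(* The product of differential operators is their composition. *)
Definition trace_diffop (F : fieldType) (k n : nat) (T : tensor F k n)
    (j : nat) (d : {ffun 'I_n -> 'I_j.+1}) :
    {mpoly F[n * n]} -> {mpoly F[n * n]} :=
  \big[comp/id]_(i < n)
    (fun p => ((d i * k.-1)%N`!%:R)^-1 *: iter (d i) (tensor_diffop T i) p).

(* The operators have order j(k-1) and act on a form of the same degree, so the
   result is a constant polynomial; it is not projected to [F]. *)
Definition tensor_trace (F : fieldType) (k n : nat) (j : nat)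
    (T : tensor F k n) : {mpoly F[n * n]} :=
  (k.-1 ^ n.-1)%N%:R *:
    \sum_(d : {ffun 'I_n -> 'I_j.+1} | (\sum_(i < n) d i == j)%N)
      trace_diffop T d (\tr (generic_mx F n ^+ (j * k.-1))).

(* Main.v *)
From HB Require Import structures.
Require Import Defs.
From mathcomp Require Import all_boot all_order all_algebra.
From mathcomp Require Import zify ring.

(* At a vertex [i] the adjacency tensor contributes the operator
   sum_(e in E_i) prod_(v in e - i) d/dx_(iv), so expanding the trace amounts to
   choosing how often [c_ie] each edge [e] is rooted at each vertex [i]; such a
   choice determines an exponent [m] of arcs (i, v), and d^m tr(X^N) is
   prod m_iv! times the number of closed walks of length N (with a starting
   point) using each arc (i, v) exactly m_iv times.  By the BEST theorem this is
   N * prod_v (outdeg v - 1)! * det L_b, with L_b a reduced Laplacian, if the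
   arcs are balanced, and 0 otherwise.  BEST follows by induction on the length:
   removing the first arc of a walk is expansion of the Laplacian along one row.
   For C_(4,k) with sum c_ie = 2k, balance at the core vertices forces
   c_ie = w_e on each edge [e], with sum w_e = 2: either one edge is used twice,
   or two adjacent edges once each, or two opposite edges once each.  In the
   first two cases the edges used share a vertex [b] and are otherwise disjoint,
   and L_b is a diagonal matrix times a perturbation of the identity of small
   rank; in the last case the support is disconnected and the determinant
   vanishes. *)

Import GRing.Theory Num.Theory.
Local Open Scope ring_scope.

(** * Walks with prescribed arc multiplicities *)

Lemma cofactor_row_eq (R : comPzRingType) (n : nat) (A B : 'M[R]_n) i j :
  (forall u v, u != i -> A u v = B u v) -> cofactor A i j = cofactor B i j.
Proof.
move=> eqAB; congr (_ * \det _); apply/matrixP => u v.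
by rewrite !mxE eqAB // eq_sym neq_lift.
Qed.

Section WalkCounting.
Variables (F : fieldType) (n : nat).
Implicit Types (m : 'X_{1..n * n}) (a b u v : 'I_n) (N : nat).

(** An exponent is read as a directed multigraph: the variable in row [u] and column [v] is the arc
    from [u] to [v], and its exponent is the multiplicity. *)
Definition arcs m u v : nat := m (mxvec_index u v).
Definition outdeg m u : nat := (\sum_v arcs m u v)%N.
Definition indeg m v : nat := (\sum_u arcs m u v)%N.
Definition mfact m : nat := (\prod_i (m i)`!)%N.

(* The rows of [b] and of the vertices without outgoing arcs are those of the
   identity, so that the determinant is the minor on the other vertices. *)
Definition laplacian b m : 'M[F]_n := \matrix_(u, v)
  if (u == b) || (outdeg m u == 0%N) then (u == v)%:R
  else (outdeg m u)%:R *+ (u == v) - (arcs m u v)%:R.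

Lemma mxvec_index_eq u v u' v' :
  (mxvec_index u v == mxvec_index u' v') = (u == u') && (v == v').
Proof.
apply/eqP/andP => [|[/eqP -> /eqP ->] //].
have [h hK _] := curry_mxvec_bij n n.
by move=> /(congr1 h) /=; rewrite (hK (u, v)) // (hK (u', v')) // => -[-> ->].
Qed.

Lemma sum_mxvec_index (f : 'I_(n * n) -> nat) :
  (\sum_k f k = \sum_u \sum_v f (mxvec_index u v))%N.
Proof.
rewrite pair_bigA /= (reindex (uncurry (@mxvec_index n n))) /=; last first.
  by apply: (subon_bij _ (curry_mxvec_bij n n)) => x; rewrite inE.
by apply: eq_bigr => -[u v].
Qed.

Lemma mdeg_outdeg m : mdeg m = (\sum_u outdeg m u)%N.
Proof. by rewrite mdegE sum_mxvec_index. Qed.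

Lemma arcs_sub m a c u v :
  arcs (m - U_(mxvec_index a c)) u v = (arcs m u v - ((a == u) && (c == v)))%N.
Proof. by rewrite /arcs mnmBE mnm1E mxvec_index_eq. Qed.

Lemma outdeg_sub m a c u : (0 < arcs m a c)%N ->
  outdeg (m - U_(mxvec_index a c)) u = (outdeg m u - (a == u))%N.
Proof.
move=> m_gt0; rewrite /outdeg (eq_bigr _ (fun v _ => arcs_sub m a c u v)).
case: (eqVneq a u) => [<-|_] /=; last first.
  by rewrite subn0; apply: eq_bigr => v _; rewrite subn0.
rewrite (bigD1 c) //= [in RHS](bigD1 c) //= eqxx addnBAC //; congr (_ + _ - _)%N.
by apply: eq_bigr => v /negPf; rewrite eq_sym => ->; rewrite subn0.
Qed.

Lemma indeg_sub m a c v : (0 < arcs m a c)%N ->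
  indeg (m - U_(mxvec_index a c)) v = (indeg m v - (c == v))%N.
Proof.
move=> m_gt0; rewrite /indeg (eq_bigr _ (fun u _ => arcs_sub m a c u v)).
case: (eqVneq c v) => [<-|_] /=; last first.
  by rewrite subn0; apply: eq_bigr => u _; rewrite andbF subn0.
rewrite (bigD1 a) //= [in RHS](bigD1 a) //= eqxx addnBAC //; congr (_ + _ - _)%N.
by apply: eq_bigr => u /negPf; rewrite eq_sym => ->; rewrite subn0.
Qed.

Lemma arcs_le_outdeg m u v : (arcs m u v <= outdeg m u)%N.
Proof. by rewrite /outdeg (bigD1 v) //= leq_addr. Qed.

Lemma arcs_le_indeg m u v : (arcs m u v <= indeg m v)%N.
Proof. by rewrite /indeg (bigD1 u) //= leq_addr. Qed.

Lemma mfact_sub m a c : (0 < arcs m a c)%N ->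
  mfact m = (arcs m a c * mfact (m - U_(mxvec_index a c)))%N.
Proof.
rewrite /mfact /arcs => m_gt0; set i := mxvec_index a c in m_gt0 *.
rewrite (bigD1 i) //= [in RHS](bigD1 i) //= mulnA mnmBE mnm1E eqxx.
rewrite subn1 -{1 2}(prednK m_gt0) factS prednK //; congr (_ * _)%N.
by apply: eq_bigr => j /negPf ne; rewrite mnmBE mnm1E eq_sym ne subn0.
Qed.

Lemma mcoeff_varM (i : 'I_(n * n)) m (p : {mpoly F[n * n]}) :
  ('X_i * p)@_m = if m i == 0%N then 0 else p@_(m - U_(i)).
Proof.
rewrite mulrC; case: eqP => [m0 | /eqP m_neq0]; last first.
  by rewrite -{1}(@submK _ U_(i) m) ?lep1mP // addmC mcoeffMX.
apply: memN_msupp_eq0; rewrite (perm_mem (msuppMX p U_(i))).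
apply/negP => /mapP[m' _ mE]; move: m0.
by rewrite mE mnmDE mnm1E eqxx.
Qed.

Local Notation X := (generic_mx F n).

(** The entry of [X ^+ N] at [(a, b)] enumerates the walks of length [N] from [a] to [b] by their
    arcs; here walks are sorted by their first arc. *)
Lemma mcoeff_generic_exprS N a b m :
  ((X ^+ N.+1) a b)@_m =
  \sum_(v | (0 < arcs m a v)%N) ((X ^+ N) v b)@_(m - U_(mxvec_index a v)).
Proof.
rewrite exprS mxE raddf_sum [RHS]big_mkcond /=; apply: eq_bigr => v _.
by rewrite mxE mcoeff_varM -/(arcs m a v) lt0n; case: eqP.
Qed.

(** The degree condition met by the arcs of a walk from [a] to [b], written without subtraction of
    natural numbers. *)
Definition balanced a b m :=
  forall u, (outdeg m u + (u == b) = indeg m u + (u == a))%N.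

Lemma balanced_sub a b c m : (0 < arcs m a c)%N ->
  balanced c b (m - U_(mxvec_index a c)) <-> balanced a b m.
Proof.
move=> m_gt0.
have := leq_trans m_gt0 (arcs_le_outdeg m a c).
have := leq_trans m_gt0 (arcs_le_indeg m a c).
move=> i1 o1; split=> bal u; move: i1 o1 (bal u); rewrite outdeg_sub ?indeg_sub //;
  rewrite ![_ == u]eq_sym; case: (eqVneq u c) => [->|_]; case: (eqVneq _ a) => [->|_] /=;
  lia.
Qed.

Lemma generic_expr_supp N a b m : ((X ^+ N) a b)@_m != 0 ->
  mdeg m = N /\ balanced a b m.
Proof.
elim: N a m => [|N IHN] a m.
  rewrite expr0 mxE; case: (eqVneq a b) => [-> | _]; last by rewrite mcoeff0 eqxx.
  rewrite mcoeff1; case: (m =P 0%MM) => [-> _ | _]; last by rewrite eqxx.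
  split=> [|u]; first by rewrite mdeg0.
  by rewrite /outdeg /indeg !big1 // => v _; rewrite /arcs mnmE.
rewrite mcoeff_generic_exprS => /eqP nz.
have [v m_gt0 nzv] : exists2 v, (0 < arcs m a v)%N &
    ((X ^+ N) v b)@_(m - U_(mxvec_index a v)) != 0.
  apply/exists_inP; apply: contraT; rewrite negb_exists_in => /forall_inP z.
  by case: nz; rewrite big1 // => v /z /negPn/eqP.
have [mN bal] := IHN _ _ nzv; split; last exact/(balanced_sub a b v).
rewrite -mN -(@submK _ U_(mxvec_index a v) m); last by rewrite lep1mP -lt0n.
by rewrite mdegD mdeg1 addn1 addmK.
Qed.

Lemma det_laplacian_closed b m (Z : {set 'I_n}) (z : 'I_n) :
  z \in Z -> b \notin Z -> (forall u, u \in Z -> outdeg m u != 0%N) ->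
  (forall u v, arcs m u v != 0%N -> (u \in Z) = (v \in Z)) ->
  \det (laplacian b m) = 0.
Proof.
(* The indicator of [Z] is in the kernel. *)
move=> zZ bZ outZ closedZ; rewrite -det_tr; apply/eqP/det0P.
exists (\row_v (v \in Z)%:R).
  by apply/eqP => /rowP /(_ z) /eqP; rewrite !mxE zZ oner_eq0.
apply/rowP => u; rewrite !mxE.
have [bu | nbu] := boolP ((u == b) || (outdeg m u == 0%N)).
  have uZ : u \notin Z.
    by case/orP: bu => [/eqP -> // | ]; apply: contraL => /outZ.
  rewrite (bigD1 u) //= big1 => [|v /negPf vu].
    by rewrite !mxE (negPf uZ) mul0r addr0.
  by rewrite !mxE bu eq_sym vu mulr0.
rewrite (eq_bigr (fun v => (v \in Z)%:R * ((outdeg m u)%:R *+ (u == v))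
   - (u \in Z)%:R * (arcs m u v)%:R)) => [|v _].
  rewrite big_split /= sumrN -mulr_sumr -natr_sum (bigD1 u) //= eqxx mulr1n.
  by rewrite big1 ?addr0 ?subrr // => v /negPf; rewrite eq_sym => ->; rewrite mulr0.
rewrite !mxE (negPf nbu) mulrBr; congr (_ - _).
by case: (eqVneq (arcs m u v) 0%N) => [->|/closedZ ->]; rewrite ?mulr0.
Qed.

(* The number of walks from [a] to [b] with arc multiplicities [m], times
   [mfact m] and divided by [(outdeg m b)`!]; it depends on [a] only through the
   condition [balanced a b m]. *)
Definition walk_count b m : F :=
  (\prod_(u | u != b) (outdeg m u).-1`!)%:R * \det (laplacian b m).

(** Only row [b] and the factorial at [b] could notice the deleted arc; that row is frozen to the
    identity and that factorial is left out of the product. *)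
Lemma walk_count_sub b c m : (0 < arcs m b c)%N ->
  walk_count b (m - U_(mxvec_index b c)) = walk_count b m.
Proof.
move=> m_gt0; rewrite /walk_count; congr (_ * _).
  congr (_%:R); apply: eq_bigr => u /negPf; rewrite eq_sym => bu.
  by rewrite outdeg_sub // bu subn0.
congr (\det _); apply/matrixP => u v; rewrite !mxE; case: (eqVneq u b) => [//|/negPf ub] /=.
by rewrite outdeg_sub // arcs_sub [b == u]eq_sym ub /= !subn0.
Qed.

Lemma laplacian_sub_row a b c m u v : a != b -> (0 < arcs m a c)%N -> u != a ->
  laplacian b (m - U_(mxvec_index a c)) u v = laplacian b m u v.
Proof.
move=> ab m_gt0 /negPf ua; rewrite !mxE outdeg_sub // arcs_sub.
by rewrite [a == u]eq_sym ua /= !subn0.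
Qed.

(** The deletion step of the BEST theorem. As long as [a] keeps an outgoing arc, deleting an arc
    from [a] to [v] changes row [a] of the Laplacian by e_v - e_a, leaves the cofactors of that row
    alone and lowers the factorial at [a]. *)
Lemma walk_count_rec a b m : a != b -> balanced a b m ->
  \sum_(v | (0 < arcs m a v)%N)
    (arcs m a v)%:R * walk_count b (m - U_(mxvec_index a v)) = walk_count b m.
Proof.
move=> ab bal; have nab := negPf ab.
have out_a : outdeg m a = (indeg m a).+1.
  by have := bal a; rewrite nab eqxx addn0 addn1.
pose P := (\prod_(u | (u != b) && (u != a)) (outdeg m u).-1`!)%N.
have prodE v : (0 < arcs m a v)%N ->
    (\prod_(u | u != b) (outdeg (m - U_(mxvec_index a v)) u).-1`! =
     (outdeg m a).-2`! * P)%N.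
  move=> m_gt0; rewrite (bigD1 a) //= outdeg_sub // eqxx subn1; congr (_ * _)%N.
  apply: eq_bigr => u /andP[_ /negPf ua].
  by rewrite outdeg_sub // eq_sym ua subn0.
have cofE v w : (0 < arcs m a v)%N ->
    cofactor (laplacian b (m - U_(mxvec_index a v))) a w =
    cofactor (laplacian b m) a w.
  by move=> m_gt0; apply: cofactor_row_eq => u w' ua; apply: laplacian_sub_row.
have [in_a0 | in_a_gt0] := posnP (indeg m a).
  (* The walk never returns to [a]: column [a] of the Laplacian is a unit vector. *)
  have arcs_a u : arcs m u a = 0%N.
    by apply/eqP; rewrite -leqn0 -in_a0 arcs_le_indeg.
  have [v m_gt0] : exists v, (0 < arcs m a v)%N.
    apply/existsP; apply: contraT => /existsPn z; move: out_a.
    by rewrite /outdeg big1 // => v _; apply/eqP; rewrite -leqn0 leqNgt.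
  have out_av : (arcs m a v + \sum_(w | w != v) arcs m a w = 1)%N.
    by move: out_a; rewrite /outdeg (bigD1 v) //= in_a0.
  have m_v : arcs m a v = 1%N by lia.
  have m_w w : w != v -> arcs m a w = 0%N.
    move=> wv; have : (\sum_(w | w != v) arcs m a w = 0)%N by lia.
    by move/eqP; rewrite sum_nat_eq0 => /forall_inP /(_ w wv) /eqP.
  rewrite (bigD1 v) //= big1 ?addr0 => [|w /andP[m_w_gt0 wv]]; last first.
    by rewrite m_w in m_w_gt0.
  rewrite m_v mul1r /walk_count prodE // (bigD1 a ab) /= out_a in_a0.
  rewrite !mul1n; congr (_ * _).
  rewrite (expand_det_col _ a) [in RHS](expand_det_col _ a).
  rewrite (bigD1 a) //= [in RHS](bigD1 a) //= !big1 ?addr0; first last.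
  - move=> u /negPf ua; rewrite laplacian_sub_row ?ua // !mxE ua mulr0n arcs_a.
    by rewrite subr0 if_same mul0r.
  - by move=> u /negPf ua; rewrite !mxE ua mulr0n arcs_a subr0 if_same mul0r.
  rewrite cofE // !mxE outdeg_sub // nab eqxx out_a in_a0 subn1 /=.
  by rewrite mulr1n arcs_a subr0.
(* Since [indeg m a] is positive, [a] keeps an outgoing arc, its row is still a genuine Laplacian
   row, and linearity in that row gives the two cofactors. *)
have detE v : (0 < arcs m a v)%N ->
    \det (laplacian b (m - U_(mxvec_index a v))) =
    \det (laplacian b m) - cofactor (laplacian b m) a a
      + cofactor (laplacian b m) a v.
  move=> m_gt0; rewrite !(expand_det_row _ a).
  under eq_bigr => w _ do rewrite cofE //.
  have -> : cofactor (laplacian b m) a v =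
      \sum_w (w == v)%:R * cofactor (laplacian b m) a w.
    rewrite (bigD1 v) //= eqxx mul1r big1 ?addr0 // => w /negPf ->.
    by rewrite mul0r.
  have -> : cofactor (laplacian b m) a a =
      \sum_w (w == a)%:R * cofactor (laplacian b m) a w.
    rewrite (bigD1 a) //= eqxx mul1r big1 ?addr0 // => w /negPf ->.
    by rewrite mul0r.
  rewrite -sumrB -big_split /=; apply: eq_bigr => w _.
  rewrite -mulrBl -mulrDl; congr (_ * _); rewrite !mxE nab /=.
  rewrite outdeg_sub // eqxx arcs_sub eqxx /= subn1 out_a /=.
  rewrite gtn_eqF // -natr1 [w == a]eq_sym [w == v]eq_sym.
  case: (eqVneq v w) => [<-|_]; last first.
    by rewrite subn0; case: (a == w); rewrite ?mulr1n ?mulr0n; ring.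
  have -> : (arcs m a v)%:R = (arcs m a v - 1)%:R + 1 :> F by rewrite natr1 subn1 prednK.
  by case: (a == v); rewrite ?mulr1n ?mulr0n; ring.
under eq_bigr => v m_gt0.
  rewrite /walk_count prodE // detE // mulrCA; over.
rewrite -mulr_sumr /walk_count (bigD1 a ab) /= -/P out_a /=.
set D := \det (laplacian b m); set cof := cofactor (laplacian b m).
have DE : D = (indeg m a).+1%:R * cof a a - \sum_v (arcs m a v)%:R * cof a v.
  rewrite /D (expand_det_row _ a).
  under eq_bigr => v _ do rewrite !mxE nab out_a /= mulrBl.
  rewrite sumrB (bigD1 a) //= eqxx mulr1n big1 ?addr0 // => v /negPf.
  by rewrite eq_sym => ->; rewrite mulr0n mul0r.
(* With d the out-degree of [a], the sum is d (D - cof_aa) + (d cof_aa - D) = (d - 1) D. *)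
have sumE : \sum_(v | (0 < arcs m a v)%N)
    (arcs m a v)%:R * (D - cof a a + cof a v) = (indeg m a)%:R * D.
  rewrite big_mkcond (eq_bigr (fun v => (arcs m a v)%:R * (D - cof a a)
      + (arcs m a v)%:R * cof a v)) => [|v _]; last first.
    by rewrite -mulrDr lt0n; case: eqP => // ->; rewrite mul0r.
  rewrite big_split /= -mulr_suml -natr_sum -/(outdeg m a) out_a.
  rewrite -[\sum_v _](subKr ((indeg m a).+1%:R * cof a a)) -DE -natr1.
  by ring.
rewrite sumE mulrA -natrM -[in RHS](prednK in_a_gt0) factS prednK //.
by rewrite mulnAC [((_)`! * _)%N in LHS]mulnC.
Qed.

(** The BEST theorem for walks from [a] to [b]. If [a] differs from [b], removing the first arc is
    [walk_count_rec]; if they agree, [walk_count] is unchanged and summing over the arcs supplies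
    the factor [outdeg m b]. *)
Lemma mcoeff_generic_expr a b m : balanced a b m ->
  ((X ^+ mdeg m) a b)@_m * (mfact m)%:R = (outdeg m b)`!%:R * walk_count b m.
Proof.
have [N mN] : exists N, mdeg m = N by exists (mdeg m).
rewrite mN.
elim: N a m mN => [|N IHN] a m mN bal.
  have m0 : m = 0%MM by apply/eqP; rewrite -mdeg_eq0 mN.
  have out0 u : outdeg m u = 0%N by rewrite /outdeg big1 // => v _; rewrite /arcs m0 mnmE.
  have in0 u : indeg m u = 0%N by rewrite /indeg big1 // => v _; rewrite /arcs m0 mnmE.
  have ab : a = b.
    by apply/eqP; move: (bal a); rewrite out0 in0 eqxx; case: eqP.
  have -> : walk_count b m = 1.
    rewrite /walk_count big1 => [|u _]; last by rewrite out0.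
    rewrite mul1r -(det1 F n); congr (\det _); apply/matrixP => u v.
    by rewrite !mxE out0 eqxx orbT.
  rewrite out0 expr0 mxE ab eqxx m0 mcoeff1 eqxx /mfact big1 // => i _.
  by rewrite mnmE.
rewrite mcoeff_generic_exprS mulr_suml.
rewrite (eq_bigr (fun v => (arcs m a v)%:R *
  ((outdeg (m - U_(mxvec_index a v)) b)`!%:R *
   walk_count b (m - U_(mxvec_index a v))))) => [|v m_gt0]; last first.
  rewrite (mfact_sub m a v m_gt0) natrM mulrCA IHN //; last exact/balanced_sub.
  by move: (mdegD (m - U_(mxvec_index a v)) U_(mxvec_index a v));
    rewrite submK ?lep1mP -?lt0n // mdeg1 addn1 mN => -[].
have [ab | ab] := eqVneq a b; last first.
  rewrite -(walk_count_rec a b m ab bal) mulr_sumr; apply: eq_bigr => v m_gt0.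
  by rewrite outdeg_sub // (negPf ab) subn0 mulrCA.
rewrite {}ab in bal *.
rewrite (eq_bigr (fun v => (arcs m b v)%:R *
   ((outdeg m b).-1`!%:R * walk_count b m))) => [|v m_gt0]; last first.
  by rewrite outdeg_sub // eqxx subn1 walk_count_sub.
rewrite -mulr_suml (_ : \sum_(v | _) _ = (outdeg m b)%:R); last first.
  rewrite /outdeg natr_sum big_mkcond; apply: eq_bigr => v _.
  by rewrite lt0n; case: eqP => // ->.
have [out_b0 | out_b_gt0] := posnP (outdeg m b); last first.
  by rewrite mulrA -natrM -[in RHS](prednK out_b_gt0) factS prednK.
(* Arcs remain but none leaves [b], so there is no closed walk from [b]. The determinant vanishes as
   well: the vertices with outgoing arcs form a closed set avoiding [b]. *)
rewrite out_b0 mul0r /walk_count.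
have [z z_gt0] : exists z, (0 < outdeg m z)%N.
  apply/existsP; apply: contraT => /existsPn z; move: mN.
  by rewrite mdeg_outdeg big1 // => v _; apply/eqP; rewrite -leqn0 leqNgt.
have in_out u : outdeg m u = indeg m u by have /eqP := bal u; rewrite eqn_add2r => /eqP.
rewrite (det_laplacian_closed b m [set u | outdeg m u != 0%N] z) ?mulr0 //.
- by rewrite inE -lt0n.
- by rewrite inE out_b0.
- by move=> u; rewrite inE.
move=> u v; rewrite !inE -!lt0n => uv_gt0.
by rewrite (leq_trans uv_gt0) ?arcs_le_outdeg // in_out (leq_trans uv_gt0) ?arcs_le_indeg.
Qed.

Lemma mderiv_generic_expr u v N :
  map_mx (mderiv (mxvec_index u v)) (X ^+ N.+1) =
  \sum_(s < N.+1) X ^+ s * delta_mx u v * X ^+ (N - s).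
Proof.
set i := mxvec_index u v.
have derM (A B : 'M[{mpoly F[n * n]}]_n) :
    map_mx (mderiv i) (A * B) = map_mx (mderiv i) A * B + A * map_mx (mderiv i) B.
  apply/matrixP => a b; rewrite !mxE raddf_sum -big_split /=.
  by apply: eq_bigr => c _; rewrite mderivM !mxE.
have derX : map_mx (mderiv i) X = delta_mx u v.
  apply/matrixP => a b; rewrite !mxE mderivX mnm1E mxvec_index_eq.
  case: (eqVneq a u) => [->|_]; last by rewrite scale0r.
  case: (eqVneq b v) => [->|_]; last by rewrite scale0r.
  by rewrite scale1r -[X in (X - _)%MM]addm0 [(_ + 0)%MM]addmC addmK mpolyX0.
elim: N => [|N IHN]; first by rewrite big_ord1 expr0 mul1r mulr1 expr1.
rewrite exprS derM derX IHN [RHS]big_ord_recl expr0 mul1r subn0 mulr_sumr.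
by congr (_ + _); apply: eq_bigr => s _; rewrite lift0 subSS !mulrA exprS.
Qed.

(** The Leibniz rule gives one term for each position of the arc, and cyclicity of the trace makes
    them all equal: every closed walk is rotated so as to start with the given arc. *)
Lemma mcoeff_trace_arc N u v m : (0 < arcs m u v)%N ->
  (\tr (X ^+ N.+1))@_m * (arcs m u v)%:R =
  N.+1%:R * ((X ^+ N) v u)@_(m - U_(mxvec_index u v)).
Proof.
move=> m_gt0; set i := mxvec_index u v.
have trD : (\tr (X ^+ N.+1))^`M(i) = ((X ^+ N) v u) *+ N.+1.
  transitivity (\tr (map_mx (mderiv i) (X ^+ N.+1))).
    by rewrite /mxtrace raddf_sum; apply: eq_bigr => a _; rewrite [RHS]mxE.
  rewrite mderiv_generic_expr raddf_sum /= -[N.+1 in RHS]card_ord -sumr_const.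
  apply: eq_bigr => s _; rewrite -mulrA -mulmxE mxtrace_mulC mulmxE.
  rewrite -mulrA -exprD subnK -1?ltnS // -mulmxE mxtrace_mulC.
  rewrite /mxtrace (bigD1 v) //= big1 ?addr0 => [|a /negPf av].
    rewrite mxE (bigD1 u) //= mxE !eqxx mulr1 big1 ?addr0 // => a /negPf au.
    by rewrite mxE au mulr0.
  by rewrite mxE big1 // => c _; rewrite mxE av andbF mulr0.
have := congr1 (mcoeff (m - U_(i))) trD.
rewrite mcoeff_mderiv submK ?lep1mP -?lt0n // mcoeffMn mnmBE mnm1E eqxx subn1.
by rewrite prednK // mulr_natr mulr_natl.
Qed.

Lemma mcoeff_trace_supp N m : (\tr (X ^+ N))@_m != 0 ->
  mdeg m = N /\ outdeg m =1 indeg m.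
Proof.
rewrite /mxtrace raddf_sum /= => /eqP nz.
have [a nza] : exists a, ((X ^+ N) a a)@_m != 0.
  apply/existsP; apply: contraT => /existsPn z.
  by case: nz; rewrite big1 // => a _; apply/eqP; rewrite -[_ == _]negbK z.
have [mN bal] := generic_expr_supp N a a m nza; split=> // u.
by have /eqP := bal u; rewrite eqn_add2r => /eqP.
Qed.

(** A closed walk is cut at an arc from [b] to some [v], leaving a walk from [v] to [b]. The cut
    lowers the out-degree of [b] by one, so its factorial completes the product over all
    vertices. *)
Lemma mcoeff_trace m b : outdeg m =1 indeg m -> (0 < outdeg m b)%N ->
  (\tr (X ^+ mdeg m))@_m * (mfact m)%:R =
  (mdeg m)%:R * (\prod_u (outdeg m u).-1`!)%:R * \det (laplacian b m).
Proof.
move=> bal out_b.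
have [v m_gt0] : exists v, (0 < arcs m b v)%N.
  apply/existsP; apply: contraT => /existsPn z; move: out_b.
  by rewrite /outdeg big1 // => v _; apply/eqP; rewrite -leqn0 leqNgt.
set m' := (m - U_(mxvec_index b v))%MM.
have mdegS : mdeg m = (mdeg m').+1.
  rewrite -{1}(@submK _ U_(mxvec_index b v) m) ?lep1mP -?lt0n //.
  by rewrite mdegD mdeg1 addn1.
rewrite (mfact_sub m b v m_gt0) natrM mulrA mdegS mcoeff_trace_arc // -/m' -!mulrA.
congr (_ * _); rewrite mcoeff_generic_expr; last first.
  by apply/balanced_sub => // u; rewrite bal.
rewrite walk_count_sub // outdeg_sub // eqxx subn1 /walk_count mulrA -natrM.
by rewrite [in RHS](bigD1 b).
Qed.

End WalkCounting.

Arguments arcs {n} m u v.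
Arguments outdeg {n} m u.
Arguments indeg {n} m v.
Arguments mfact {n} m.

(** * Differential operators and the multinomial theorem *)

Lemma mpolyX_sum (R : comNzRingType) (n : nat) (I : finType) (m : I -> 'X_{1..n}) :
  'X_[\sum_i m i] = \prod_i 'X_[m i] :> {mpoly R[n]}.
Proof. exact: (big_morph _ (@mpolyXD n R) (@mpolyX0 n R)). Qed.

Section DifferentialOperators.
Variables (R : comNzRingType) (n : nat).
Implicit Types (m : 'X_{1..n}) (p Q : {mpoly R[n]}).

(** The constant-coefficient operator obtained from its symbol [Q] by replacing each variable with
    the corresponding partial derivative. *)
Definition diffop Q p : {mpoly R[n]} := \sum_(m <- msupp Q) Q@_m *: p^`M[m].

(** A list larger than the support may index the sum, so that symbols with different supports can be
    added over one list. *)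
Lemma diffopE (s : seq 'X_{1..n}) Q p : uniq s -> {subset msupp Q <= s} ->
  diffop Q p = \sum_(m <- s) Q@_m *: p^`M[m].
Proof.
move=> uniq_s sQs; rewrite /diffop (perm_big [seq m <- s | m \in msupp Q]) /=.
  rewrite big_filter big_mkcond /=; apply: eq_bigr => m _.
  by case: ifPn => // /memN_msupp_eq0 ->; rewrite scale0r.
apply: uniq_perm; rewrite ?filter_uniq ?msupp_uniq // => m.
by rewrite mem_filter; case: (boolP (m \in msupp Q)) => // /sQs ->.
Qed.

Lemma diffopX m p : diffop 'X_[m] p = p^`M[m].
Proof. by rewrite /diffop msuppX big_seq1 mcoeffX eqxx scale1r. Qed.

(** The arguments are swapped so that linearity in the symbol can be registered as an instance. *)
Definition diffop_at p Q := diffop Q p.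

Lemma diffop_at_is_linear p : linear (diffop_at p).
Proof.
move=> a Q Q'; rewrite /diffop_at; pose s := undup (msupp (a *: Q + Q') ++ msupp Q ++ msupp Q').
rewrite !(@diffopE s) ?undup_uniq //; last 3 first.
- by move=> m mQ; rewrite mem_undup !mem_cat mQ ?orbT.
- by move=> m mQ; rewrite mem_undup !mem_cat mQ ?orbT.
- by move=> m mQ; rewrite mem_undup !mem_cat mQ ?orbT.
rewrite scaler_sumr -big_split /=; apply: eq_bigr => m _.
by rewrite mcoeffD mcoeffZ scalerDl scalerA.
Qed.

HB.instance Definition _ p :=
  GRing.isLinear.Build R {mpoly R[n]} {mpoly R[n]} _ (diffop_at p) (diffop_at_is_linear p).

Lemma diffopZl a Q p : diffop (a *: Q) p = a *: diffop Q p.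
Proof. by rewrite -!/(diffop_at p _) linearZ. Qed.

Lemma diffop_sum (I : Type) (s : seq I) (P : pred I) (f : I -> {mpoly R[n]}) p :
  diffop (\sum_(i <- s | P i) f i) p = \sum_(i <- s | P i) diffop (f i) p.
Proof. exact: (raddf_sum (diffop_at p)). Qed.

Lemma diffop_is_linear Q : linear (diffop Q).
Proof.
move=> a p p'; rewrite /diffop scaler_sumr -big_split /=.
apply: eq_bigr => m _; rewrite linearP scalerDr !scalerA.
by rewrite [_ * a]mulrC.
Qed.

HB.instance Definition _ Q :=
  GRing.isLinear.Build R {mpoly R[n]} {mpoly R[n]} _ (diffop Q) (diffop_is_linear Q).

(** Linearity in both symbols reduces composition to monomials, where the exponents of the
    derivatives add. *)
Lemma diffopM Q Q' p : diffop (Q * Q') p = diffop Q (diffop Q' p).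
Proof.
rewrite -!/(diffop_at _ _).
elim/mpolyind: Q => [|c m Q _ _ IHQ]; first by rewrite mul0r !raddf0.
rewrite mulrDl !raddfD /= IHQ; congr (_ + _).
rewrite -scalerAl !linearZ /=; congr (_ *: _).
rewrite -[RHS]/(diffop _ (diffop_at p Q')).
elim/mpolyind: Q' {IHQ} => [|c' m' Q' _ _ IHQ']; first by rewrite mulr0 !raddf0.
rewrite mulrDr !raddfD /= IHQ'; congr (_ + _).
rewrite -scalerAr !linearZ /=; congr (_ *: _).
by rewrite -mpolyXD /diffop_at !diffopX addmC mderivmDm.
Qed.

Lemma diffop1 p : diffop 1 p = p.
Proof. by rewrite -mpolyX0 diffopX mderivm0m. Qed.

Lemma iter_diffop d Q p : iter d (diffop Q) p = diffop (Q ^+ d) p.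
Proof. by elim: d => [|d /= ->]; rewrite ?diffop1 // exprS diffopM. Qed.

End DifferentialOperators.

Arguments diffop {R n} Q p.
Arguments diffop_at {R n} p Q.

Section MultinomialTheorem.
Variables (F : fieldType) (A : comAlgType F).
Hypothesis char0 : forall d : nat, d.+1%:R != 0 :> F.

Lemma fact_neq0 d : d`!%:R != 0 :> F.
Proof. by rewrite -(prednK (fact_gt0 d)). Qed.

(* The exponential [exp (a 'X)], truncated after degree [K]. *)
Definition expr_fact (K : nat) (a : A) : {poly A} :=
  \poly_(c < K.+1) ((c`!%:R : F)^-1 *: a ^+ c).

(** This is exp(a) exp(b) = exp(a + b), with the binomial theorem as induction step; the truncation
    does not affect degrees up to [K]. *)
Lemma coef_prod_expr_fact (K d : nat) (I : Type) (s : seq I) (a : I -> A) :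
  (d <= K)%N ->
  (\prod_(e <- s) expr_fact K (a e))`_d =
  (d`!%:R : F)^-1 *: (\sum_(e <- s) a e) ^+ d.
Proof.
elim: s d => [|e s IHs] d ledK.
  rewrite !big_nil coef1 expr0n; case: d {ledK} => [|d] /=; last by rewrite scaler0.
  by rewrite fact0 invr1 scale1r.
rewrite !big_cons coefM addrC exprDn scaler_sumr; apply: eq_bigr => i _.
have leid : (i <= d)%N by rewrite -ltnS.
rewrite coef_poly ltnS (leq_trans leid ledK) IHs; last first.
  by rewrite (leq_trans (leq_subr _ _) ledK).
rewrite -scalerAl -scalerAr scalerA [a e ^+ i * _]mulrC -scaler_nat scalerA.
congr (_ *: _); rewrite -(bin_fact leid) !natrM !invfM.
have nz : 'C(d, i)%:R != 0 :> F.
  have := fact_neq0 d; rewrite -(bin_fact leid) natrM mulf_eq0.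
  by apply: contraNneq => ->; rewrite eqxx.
by field; rewrite nz !fact_neq0.
Qed.

(** The bound [K] is kept apart from [d] so that powers with different exponents are expanded over
    the same index type. *)
Lemma expr_sum_multinomial (K d : nat) (I : finType) (a : I -> A) : (d <= K)%N ->
  (\sum_e a e) ^+ d =
  \sum_(c : {ffun I -> 'I_K.+1} | (\sum_e c e == d)%N)
    (d`!%:R * \prod_e (c e)`!%:R^-1) *: \prod_e a e ^+ c e.
Proof.
move=> ledK; have := @coef_prod_expr_fact K d I (index_enum I) a ledK.
move/(congr1 ( *:%R d`!%:R)); rewrite scalerA divff ?fact_neq0 // scale1r => <-.
rewrite /expr_fact; under eq_bigr => e _ do rewrite poly_def.
rewrite (bigA_distr_bigA (fun e (c : 'I_K.+1) =>
  ((c`!%:R : F)^-1 *: a e ^+ c) *: 'X^c)) coef_sum scaler_sumr [RHS]big_mkcond.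
apply: eq_bigr => c _; rewrite scaler_prod prodrXr coefZ coefXn eq_sym.
case: eqP => _; last by rewrite mulr0 scaler0.
by rewrite mulr1 scaler_prod scalerA.
Qed.

End MultinomialTheorem.

(** * The trace of a uniform hypergraph *)

Section HypergraphTrace.
Variables (F : numFieldType) (k n r : nat) (E : 'I_r -> {set 'I_n}).
Hypothesis k_gt0 : (0 < k)%N.
Hypothesis E_inj : injective E.
Hypothesis E_unif : forall e, #|E e| = k.
Let H : hypergraph n := [set E e | e : 'I_r].
Implicit Types (i u v : 'I_n) (e : 'I_r).

(** The trace is homogeneous of degree [N], so a derivative of that order retains a single
    coefficient, times the factorials produced by differentiation. *)
Lemma mderivm_trace (N : nat) (m : 'X_{1..n * n}) : mdeg m = N ->
  (\tr (generic_mx F n ^+ N))^`M[m] =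
  ((\tr (generic_mx F n ^+ N))@_m * (mfact m)%:R)%:MP.
Proof.
move=> mN; apply/mpolyP => m'; rewrite mcoeff_mderivm mcoeffC.
have [<- | m'_neq0] := eqVneq 0%MM m'; last first.
  rewrite mulr0 [X in X *+ _](_ : _ = 0) ?mul0rn //; apply: contraNeq m'_neq0.
  case/mcoeff_trace_supp; rewrite mdegD mN -[RHS]addn0 => /addnI /eqP.
  by rewrite mdeg_eq0 eq_sym.
rewrite addm0 mulr1 mulr_natr; congr (_ *+ _).
by apply: eq_bigr => i _; rewrite ffactnn.
Qed.

(** Rooting [e] at [i] yields one arc from [i] to each other vertex of [e]. *)
Definition edge_arcs i e : 'X_{1..n * n} :=
  (\sum_(v in E e :\ i) U_(mxvec_index i v))%MM.

Lemma partial_tupleE i (l : k.-1.-tuple 'I_n) (p : {mpoly F[n * n]}) :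
  partial_tuple i l p = p^`M[\sum_(v <- l) U_(mxvec_index i v)].
Proof.
rewrite /partial_tuple; elim: (tval l) => [|v s IHs] /=.
  by rewrite big_nil mderivm0m.
by rewrite big_cons addmC mderivmDm -IHs mderivmU1m.
Qed.

Lemma edge_tuple_uniq i e (l : k.-1.-tuple 'I_n) :
  [set x in i :: l] = E e -> uniq (i :: l).
Proof.
move=> lE; apply/card_uniqP; rewrite /= size_tuple prednK //.
by apply: etrans (E_unif e); rewrite -lE cardsE.
Qed.

Lemma edge_tupleE i e (l : k.-1.-tuple 'I_n) : i \in E e ->
  ([set x in i :: l] == E e) = all (mem (E e :\ i)) l && uniq l.
Proof.
move=> iE; apply/eqP/andP => [lE | [/allP l_sub l_uniq]].
  have := edge_tuple_uniq i e l lE; rewrite cons_uniq => /andP[iNl l_uniq].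
  split=> //; apply/allP => v vl; rewrite !inE -lE !inE.
  by rewrite vl orbT andbT; apply: contraNneq iNl => <-.
apply/eqP; rewrite eqEcard; apply/andP; split.
  apply/subsetP => v; rewrite !inE => /orP[/eqP -> // | /l_sub].
  by rewrite !inE => /andP[].
have /card_uniqP il : uniq (i :: l).
  by rewrite /= l_uniq andbT; apply/negP => /l_sub; rewrite !inE eqxx.
by rewrite E_unif cardsE il /= size_tuple prednK.
Qed.

Definition edge_op i : {mpoly F[n * n]} :=
  \sum_e (i \in E e)%:R *: 'X_[edge_arcs i e].

(** The (k-1)! orderings of the vertices of [e] other than [i] give the same derivative, which
    cancels the normalisation of the tensor. *)
Lemma adjacency_diffop i (p : {mpoly F[n * n]}) :
  tensor_diffop (adjacency_tensor F k H) i p = diffop (edge_op i) p.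
Proof.
have fact_neq0 : (k.-1)`!%:R != 0 :> F by rewrite pnatr_eq0 -lt0n fact_gt0.
have adjE (l : k.-1.-tuple 'I_n) : adjacency_tensor F k H i l =
    \sum_e ([set x in i :: l] == E e)%:R * (k.-1)`!%:R^-1.
  rewrite /adjacency_tensor; case: ifP => [/imsetP[e _ ->] | lH].
    rewrite (bigD1 e) //= eqxx mul1r big1 ?addr0 // => e' /negPf.
    by rewrite (inj_eq E_inj) eq_sym => ->; rewrite mul0r.
  rewrite big1 // => e _; case: eqP => [lE|_]; last by rewrite mul0r.
  by rewrite lE imset_f in lH.
rewrite /tensor_diffop diffop_sum.
under eq_bigr => l _ do rewrite adjE scaler_suml.
rewrite exchange_big; apply: eq_bigr => e _.
rewrite diffopZl diffopX.
case: (boolP (i \in E e)) => iE; last first.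
  rewrite scale0r big1 // => l _; case: eqP => [lE | _]; last by rewrite mul0r scale0r.
  by case/negP: iE; rewrite -lE !inE eqxx.
under eq_bigr => l _ do rewrite edge_tupleE //.
rewrite (bigID (fun l : k.-1.-tuple 'I_n => all (mem (E e :\ i)) l && uniq l)) /=.
rewrite addrC big1 ?add0r => [|l /negPf ->]; last by rewrite mul0r scale0r.
rewrite (eq_bigr (fun=> (k.-1)`!%:R^-1 *: p^`M[edge_arcs i e])); last first.
  move=> l lE; rewrite lE mul1r partial_tupleE; congr (_ *: _^`M[_]).
  have /andP[_ l_uniq] := lE; rewrite big_uniq //; apply: eq_bigl => v.
  move: lE; rewrite -edge_tupleE // => /eqP lE; rewrite !inE -lE !inE.
  have /andP[iNl _] := edge_tuple_uniq i e l lE.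
  by case: eqVneq => [->|]; rewrite ?(negPf iNl).
rewrite sumr_const -cardsE card_uniq_tuples.
have -> : #|mem (E e :\ i)| = k.-1.
  by have := cardsD1 i (E e); rewrite iE E_unif => -> /=.
by rewrite ffactnn -scaler_nat scalerA divff.
Qed.

Lemma trace_diffopE (j : nat) (d : {ffun 'I_n -> 'I_j.+1}) (p : {mpoly F[n * n]}) :
  trace_diffop (adjacency_tensor F k H) d p =
  diffop (\prod_i (((d i * k.-1)%N`!%:R)^-1 *: edge_op i ^+ d i)) p.
Proof.
rewrite /trace_diffop; elim: (index_enum _) p => [|i s IHs] p.
  by rewrite !big_nil diffop1.
rewrite !big_cons /= diffopM IHs diffopZl.
congr (_ *: _); rewrite -iter_diffop.
by apply: eq_iter => q; rewrite adjacency_diffop.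
Qed.

(** * Expansion of the trace over the choices of roots *)

Section Expansion.
Variable j : nat.
Let cnt := {ffun 'I_n -> {ffun 'I_r -> 'I_j.+1}}.
Implicit Type f : cnt.

Definition rootdeg f i : nat := (\sum_e f i e)%N.

Definition rooted f := [forall i, forall e, (f i e != 0%N :> nat) ==> (i \in E e)].

Definition arc_count f : 'X_{1..n * n} :=
  (\sum_i \sum_e edge_arcs i e *+ f i e)%MM.

(** At each vertex, the factor 1/(d(k-1))! of the trace formula times the multinomial coefficient
    from the [d]-th power of [edge_op i], where d is [rootdeg f i]. *)
Definition weight f : F :=
  \prod_i ((rootdeg f i)`!%:R / (rootdeg f i * k.-1)`!%:R * \prod_e (f i e)`!%:R^-1).

(** Rooting an edge at a vertex outside it meets the scalar 0 of [edge_op], while exponent 0 gives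
    1. *)
Lemma edge_op_expr_prod f :
  \prod_i \prod_e ((i \in E e)%:R *: 'X_[edge_arcs i e] : {mpoly F[n * n]}) ^+ f i e =
  (rooted f)%:R *: 'X_[arc_count f].
Proof.
rewrite /arc_count mpolyX_sum.
under [in RHS]eq_bigr => i _ do rewrite mpolyX_sum.
under eq_bigr => i _ do under eq_bigr => e _ do rewrite exprZn mpolyXn.
under eq_bigr => i _ do rewrite scaler_prod.
rewrite scaler_prod; congr (_ *: _).
have [rf | /forallPn[i /forallPn[e]]] := boolP (rooted f).
  rewrite big1 // => i _; rewrite big1 // => e _.
  have /implyP := forallP (forallP rf i) e.
  by case: eqP => [-> | _ ->]; rewrite ?expr0 ?expr1n.
rewrite negb_imply => /andP[/negPf fie /negPf iE].
by rewrite (bigD1 i) //= (bigD1 e) //= iE expr0n fie !mul0r.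
Qed.

Lemma mdeg_arc_count f : rooted f ->
  mdeg (arc_count f) = (\sum_i rootdeg f i * k.-1)%N.
Proof.
move=> /forallP rf; rewrite /arc_count mdeg_sum.
apply: eq_bigr => i _; rewrite mdeg_sum big_distrl; apply: eq_bigr => e _.
rewrite mdegMn mulnC; have /implyP := forallP (rf i) e.
case: eqP => [-> // | _ /(_ isT) iE]; congr (_ * _)%N.
rewrite mdeg_sum (eq_bigr (fun=> 1%N)) => [|v _]; last by rewrite mdeg1.
by rewrite sum1_card; have := cardsD1 i (E e); rewrite iE E_unif => -> /=.
Qed.

(** A degree vector [d] together with a multinomial choice at every vertex amounts to a single [f],
    whose root degrees recover [d]. *)
Lemma adjacency_traceE :
  tensor_trace j (adjacency_tensor F k H) =
  ((k.-1 ^ n.-1)%N%:R * \sum_(f : cnt | (\sum_i rootdeg f i == j)%N && rooted f)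
     weight f * ((\tr (generic_mx F n ^+ (j * k.-1)))@_(arc_count f)
                 * (mfact (arc_count f))%:R))%:MP.
Proof.
rewrite /tensor_trace mpolyCM mul_mpolyC; congr (_ *: _).
set tr := \tr _; rewrite raddf_sum /=.
under eq_bigr => d _ do rewrite trace_diffopE.
have weighted f : diffop (\prod_i (((rootdeg f i * k.-1)`!%:R)^-1 *:
    (((rootdeg f i)`!%:R * \prod_e (f i e)`!%:R^-1) *:
     \prod_e ((i \in E e)%:R *: 'X_[edge_arcs i e]) ^+ f i e))) tr =
    (weight f * (rooted f)%:R) *: tr^`M[arc_count f].
  under eq_bigr => i _ do rewrite scalerA.
  rewrite scaler_prod edge_op_expr_prod !diffopZl scalerA diffopX.
  congr (_ * _ *: _); apply: eq_bigr => i _.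
  by rewrite mulrCA mulrA.
transitivity (\sum_(f : cnt | (\sum_i rootdeg f i == j)%N)
    (weight f * (rooted f)%:R) *: tr^`M[arc_count f]); last first.
  rewrite [LHS](bigID rooted) /= [X in _ + X]big1 ?addr0; last first.
    by move=> f /andP[_ /negPf ->]; rewrite mulr0 scale0r.
  apply: eq_bigr => f /andP[/eqP ftot rf]; rewrite rf mulr1.
  by rewrite mderivm_trace ?mdeg_arc_count -?big_distrl ?ftot // -mul_mpolyC -mpolyCM.
have total_le f i : (\sum_i rootdeg f i = j -> rootdeg f i <= j)%N.
  by move=> <-; rewrite (bigD1 i) //= leq_addr.
rewrite [RHS](partition_big (fun f : cnt => [ffun i => inord (rootdeg f i) : 'I_j.+1])
  (fun d : {ffun 'I_n -> 'I_j.+1} => \sum_i d i == j)%N) /=; last first.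
  move=> f /eqP ftot; rewrite -[X in _ == X]ftot; apply/eqP/eq_bigr => i _.
  by rewrite ffunE inordK // ltnS total_le.
apply: eq_bigr => d /eqP dtot.
have dle i : (d i <= j)%N by rewrite -ltnS.
under eq_bigr => i _.
  rewrite /edge_op (expr_sum_multinomial _ _ _ j) ?dle //; last first.
    by move=> q; rewrite pnatr_eq0.
  rewrite scaler_sumr; over.
rewrite bigA_distr_big_dep diffop_sum.
apply: eq_big => [f | f].
  apply/familyP/andP => [fd | [/eqP ftot /eqP fd] i].
    have totE i : rootdeg f i = d i by have /eqP := fd i.
    split; first by rewrite -dtot; apply/eqP/eq_bigr => i _.
    by apply/eqP/ffunP => i; rewrite ffunE totE inord_val.
  by rewrite -fd ffunE; apply/eqP; rewrite inordK // ltnS total_le.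
move=> /familyP fd; rewrite -weighted; congr diffop; apply: eq_bigr => i _.
by have /eqP := fd i; rewrite -/(rootdeg f i) => ->.
Qed.

End Expansion.
End HypergraphTrace.

Arguments edge_arcs {n r} E i e.
Arguments rootdeg {n r j} f i.
Arguments rooted {n r} E {j} f.
Arguments arc_count {n r} E {j} f.
Arguments weight F k {n r j} f.

(** * Edges sharing a single vertex *)

(** Sylvester's determinant identity, from two block triangular factorisations of one matrix. *)
Lemma det_1_sub_mulmx (R : comNzRingType) (n r : nat)
    (U : 'M[R]_(n, r)) (V : 'M[R]_(r, n)) :
  \det (1%:M - U *m V) = \det (1%:M - V *m U).
Proof.
have l : block_mx 1%:M U V 1%:M =
    block_mx 1%:M 0 V 1%:M *m block_mx 1%:M U 0 (1%:M - V *m U).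
  by rewrite mulmx_block !mul1mx !mulmx0 !mul0mx !mulmx1 !addr0 addrC subrK.
have u : block_mx 1%:M U V 1%:M =
    block_mx 1%:M U 0 1%:M *m block_mx (1%:M - U *m V) 0 V 1%:M.
  by rewrite mulmx_block !mul1mx !mulmx0 !mul0mx !mulmx1 !add0r subrK.
have := congr1 determinant l; rewrite {1}u !det_mulmx !det_ublock !det_lblock.
by rewrite !det1 !mul1r !mulr1.
Qed.

(** * Degrees of the arcs produced by rooted edges *)

Section EdgeCounts.
Variables (k n r j : nat) (E : 'I_r -> {set 'I_n}).
Hypothesis k_gt0 : (0 < k)%N.
Hypothesis E_unif : forall e, #|E e| = k.
Variable f : {ffun 'I_n -> {ffun 'I_r -> 'I_j.+1}}.
Hypothesis rf : rooted E f.
Let m := arc_count E f.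
Let s e := (\sum_u f u e)%N.

Lemma rooted_eq0 u e : u \notin E e -> f u e = 0%N :> nat.
Proof.
have /implyP := forallP (forallP rf u) e.
by case: eqP => // _ /(_ isT) ->.
Qed.

Lemma arcs_arc_count u v : arcs m u v = (\sum_e f u e * (v \in E e :\ u))%N.
Proof.
rewrite /arcs /m /arc_count mnm_sumE (bigD1 u) //= [X in (_ + X)%N]big1 ?addn0.
  rewrite mnm_sumE; apply: eq_bigr => e _; rewrite mulmnE mulnC; congr (_ * _)%N.
  rewrite /edge_arcs mnm_sumE.
  under eq_bigr => v' _ do rewrite mnm1E mxvec_index_eq eqxx /=.
  have [vE | vE] := boolP (v \in _).
    by rewrite (bigD1 v) //= eqxx big1 // => v' /andP[_ /negPf ->].
  by rewrite big1 // => v' v'E; case: eqP => // v'v; rewrite -v'v v'E in vE.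
move=> u' /negPf u'u; rewrite mnm_sumE big1 // => e _; rewrite mulmnE.
rewrite /edge_arcs mnm_sumE big1 // => v' _.
by rewrite mnm1E mxvec_index_eq u'u.
Qed.

Lemma outdeg_arc_count u : outdeg m u = (rootdeg f u * k.-1)%N.
Proof.
rewrite /outdeg; under eq_bigr => v _ do rewrite arcs_arc_count.
rewrite exchange_big big_distrl /=; apply: eq_bigr => e _.
rewrite -big_distrr /=.
have [uE | uE] := boolP (u \in E e); last by rewrite (rooted_eq0 _ _ uE).
congr (_ * _)%N; have := cardsD1 u (E e); rewrite uE E_unif => -> /=.
by rewrite -sum1_card [RHS]big_mkcond; apply: eq_bigr => v _; case: (_ \in _).
Qed.

(** An edge enters its vertex [v] once for each rooting at another of its vertices; the rootings at
    [v] itself complete the total [s e]. *)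
Lemma indeg_arc_count v :
  (indeg m v + rootdeg f v = \sum_(e | v \in E e) s e)%N.
Proof.
rewrite /indeg; under eq_bigr => u _ do rewrite arcs_arc_count.
rewrite exchange_big -big_split [RHS]big_mkcond /=; apply: eq_bigr => e _.
case: ifPn => [vE | vE]; last first.
  rewrite (rooted_eq0 _ _ vE) addn0 big1 // => u _.
  by rewrite !inE (negPf vE) andbF muln0.
rewrite /s (bigD1 v) //= [in RHS](bigD1 v) //= !inE eqxx muln0 add0n addnC.
congr (_ + _)%N; apply: eq_bigr => u uv.
by rewrite !inE vE eq_sym uv muln1.
Qed.

Lemma arc_count_balanced :
  (outdeg m =1 indeg m) <->
  (forall v, k * rootdeg f v = \sum_(e | v \in E e) s e)%N.
Proof.
have kE v : (k * rootdeg f v = outdeg m v + rootdeg f v)%N.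
  by rewrite outdeg_arc_count -{1}(prednK k_gt0) mulSn mulnC addnC.
split=> bal v; first by rewrite kE bal indeg_arc_count.
by have := bal v; rewrite kE -indeg_arc_count => /addIn.
Qed.

End EdgeCounts.

(** * Contribution of edges that meet only in a common vertex *)

Section Star.
Variables (F : numFieldType) (k n r j : nat) (E : 'I_r -> {set 'I_n}).
Hypothesis k_gt1 : (1 < k)%N.
Hypothesis E_unif : forall e, #|E e| = k.
Variables (w : 'I_r -> nat) (b : 'I_n).
Variable f : {ffun 'I_n -> {ffun 'I_r -> 'I_j.+1}}.
(** A used edge is rooted equally often at each of its vertices; on the four-cycle, balance will
    force this shape. *)
Hypothesis fE : forall u e, f u e = (if u \in E e then w e else 0%N) :> nat.
Hypothesis w_gt0 : (0 < \sum_e w e)%N.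
Hypothesis center : forall e, (0 < w e)%N -> b \in E e.
Hypothesis meet : forall e e' u, (0 < w e)%N -> (0 < w e')%N ->
  u \in E e -> u \in E e' -> e != e' -> u = b.
Let m := arc_count E f.
Let k_gt0 : (0 < k)%N := ltnW k_gt1.

Lemma star_rooted : rooted E f.
Proof. by apply/forallP => u; apply/forallP => e; apply/implyP; rewrite fE; case: ifP. Qed.

Lemma star_balanced : outdeg m =1 indeg m.
Proof.
apply/(arc_count_balanced _ _ _ _ _ k_gt0 E_unif _ star_rooted) => v.
rewrite /rootdeg big_distrr [RHS]big_mkcond /=; apply: eq_bigr => e _.
rewrite fE; case: ifP => _; last by rewrite muln0.
rewrite (eq_bigr (fun u => if u \in E e then w e else 0)%N) => [|u _]; last exact: fE.
by rewrite -big_mkcond sum_nat_const E_unif.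
Qed.

Lemma star_total_center : rootdeg f b = (\sum_e w e)%N.
Proof.
rewrite /rootdeg; apply: eq_bigr => e _; rewrite fE; case: ifPn => // bE.
by case: (posnP (w e)) => // /center; rewrite (negPf bE).
Qed.

Lemma star_other u e e' : u != b -> (0 < w e)%N -> u \in E e -> e' != e ->
  f u e' = 0%N :> nat.
Proof.
move=> ub we uE e'e; rewrite fE; case: ifP => // uE'; case: (posnP (w e')) => // we'.
by rewrite (meet e' e u) ?eqxx in ub.
Qed.

Lemma star_total u e : u != b -> (0 < w e)%N -> u \in E e -> rootdeg f u = w e.
Proof.
move=> ub we uE; rewrite /rootdeg (bigD1 e) //= fE uE big1 ?addn0 // => e' e'e.
exact: (star_other u e).
Qed.

Lemma star_total0 u : (forall e, (0 < w e)%N -> u \notin E e) -> rootdeg f u = 0%N.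
Proof.
move=> uE; rewrite /rootdeg; apply: big1 => e _; rewrite fE; case: ifPn => // ue.
by case: (posnP (w e)) => // /uE; rewrite ue.
Qed.

Lemma starP u : (exists2 e, (0 < w e)%N & u \in E e) \/
  (forall e, (0 < w e)%N -> u \notin E e).
Proof.
have [/exists_inP | ne] := boolP [exists (e | (0 < w e)%N), u \in E e]; first by left.
by right=> e we; apply: contra ne => uE; apply/exists_inP; exists e.
Qed.

Lemma star_factor (g : 'I_r -> F) u e : u != b -> (0 < w e)%N -> u \in E e ->
  \prod_(e' | (0 < w e')%N) (if u \in E e' then g e' else 1) = g e.
Proof.
move=> ub we uE; rewrite (bigD1 e) //= uE big1 ?mulr1 // => e' /andP[we' e'e].
by case: ifP => // uE'; rewrite (meet e' e u) ?eqxx in ub.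
Qed.

Lemma star_prod (g : 'I_r -> F) :
  \prod_(u | u != b) \prod_(e | (0 < w e)%N) (if u \in E e then g e else 1) =
  \prod_(e | (0 < w e)%N) g e ^+ k.-1.
Proof.
rewrite exchange_big; apply: eq_bigr => e we /=.
rewrite -big_mkcondr /= -(E_unif e) (cardsD1 b) center //= -prodr_const.
by apply: eq_bigl => u; rewrite !inE.
Qed.

(** The Laplacian is [D] (1 - [U] [V]), where [D] holds k w_e at the vertices of a used edge [e]
    other than [b]. Used edges share only [b], so [V] [U] is diagonal with entries (k-1)/k at the
    used edges, and Sylvester's identity leaves a factor 1/k for each. *)
Lemma det_star : \det (laplacian F n b m) =
  \prod_(e | (0 < w e)%N) ((k * w e)%:R ^+ k.-1 / k%:R).
Proof.
pose D : 'rV[F]_n := \row_u if u == b then 1 else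
  \prod_(e | (0 < w e)%N) (if u \in E e then (k * w e)%:R else 1).
pose U : 'M[F]_(n, r) := \matrix_(u, e)
  [&& (0 < w e)%N, u \in E e & u != b]%:R.
pose V : 'M[F]_(r, n) := \matrix_(e, v) ([&& (0 < w e)%N & v \in E e]%:R / k%:R).
have k_neq0 : k%:R != 0 :> F by rewrite pnatr_eq0 -lt0n.
have -> : laplacian F n b m = diag_mx D *m (1%:M - U *m V).
  apply/matrixP => u v; rewrite mul_diag_mx !mxE.
  rewrite (outdeg_arc_count _ _ _ _ _ E_unif _ star_rooted).
  have [-> | ub] /= := eqVneq u b.
    rewrite mul1r big1 ?subr0 // => e _.
    by rewrite !mxE eqxx !andbF mul0r.
  have [[e we uE] | uE] := starP u; last first.
    rewrite star_total0 // mul0n eqxx !big1 ?mul1r ?subr0 // => e.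
      by rewrite !mxE; case: posnP => //=; rewrite ?mul0r // => /uE/negPf ->; rewrite mul0r.
    by move=> /uE/negPf ->.
  have k1_gt0 : (0 < k.-1)%N by rewrite -subn1 subn_gt0.
  rewrite (star_total u e) // muln_eq0 !gtn_eqF ?(star_factor _ u e) //=.
  rewrite arcs_arc_count (bigD1 e) //= big1 => [|e' e'e]; last first.
    by rewrite (star_other u e).
  rewrite (bigD1 e) //= big1 => [|e' e'e]; last first.
    rewrite !mxE ub andbT; case: posnP => we' /=; first by rewrite mul0r.
    case: (boolP (u \in E e')) => uE'; last by rewrite mul0r.
    by rewrite (meet e' e u) ?eqxx in ub.
  rewrite !mxE we ub uE fE uE !addr0 addn0 mul1r !inE /=.
  have k1E : k.-1%:R = k%:R - 1 :> F by rewrite -{2}(prednK k_gt0) -natr1 addrK.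
  rewrite [v == u]eq_sym; case: (eqVneq u v) => [<-|_] /=; case: (v \in E e);
    rewrite ?uE /= ?muln1 ?muln0 ?mulr1n ?mulr0n ?natrM ?k1E; by field.
rewrite det_mulmx det_diag det_1_sub_mulmx.
have -> : \prod_i D 0 i = \prod_(e | (0 < w e)%N) (k * w e)%:R ^+ k.-1.
  rewrite -star_prod (bigD1 b) //= !mxE eqxx mul1r.
  by apply: eq_bigr => u /negPf ub; rewrite mxE ub.
have -> : 1%:M - V *m U = diag_mx (\row_e if (0 < w e)%N then k%:R^-1 else 1).
  apply/matrixP => e e'; rewrite !mxE.
  case: (posnP (w e)) => we /=.
    rewrite big1 ?subr0 // => u _.
    by rewrite !mxE we /= !mul0r.
  have [<- | ee'] := eqVneq e e'; last first.
    rewrite !mulr0n sub0r big1 ?oppr0 // => u _; rewrite !mxE.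
    case: (posnP (w e')) => we' /=; first by rewrite mulr0.
    case: (boolP (u \in E e)) => uE; last by rewrite andbF !mul0r.
    case: (boolP (u \in E e')) => uE'; last by rewrite mulr0.
    by rewrite (meet e e' u) // eqxx mulr0.
  rewrite (eq_bigr (fun u => (if u \in E e :\ b then k%:R^-1 else 0))); last first.
    move=> u _; rewrite !mxE !inE we /=; case: (u \in E e) => /=; last by rewrite andbF !mul0r.
    by rewrite mul1r andbT; case: eqP => _; rewrite ?mulr0 ?mulr1.
  rewrite -big_mkcond sumr_const.
  have -> : #|E e :\ b| = k.-1 by have := cardsD1 b (E e); rewrite center // E_unif => -> /=.
  have k1E : k.-1%:R = k%:R - 1 :> F by rewrite -{2}(prednK k_gt0) -natr1 addrK.
  by rewrite -[X in _ - X]mulr_natl k1E /= !mulr1n; field.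
rewrite det_diag big_split /=; congr (_ * _).
rewrite [RHS]big_mkcond; apply: eq_bigr => e _.
by rewrite mxE.
Qed.

Lemma star_term :
  weight F k f * ((\tr (generic_mx F n ^+ mdeg m))@_m * (mfact m)%:R) =
  (mdeg m)%:R * ((\sum_e w e).-1`!%:R / (k.-1%:R * \prod_e (w e)`!%:R)) *
  \prod_(e | (0 < w e)%N) (k%:R ^+ k.-2 / k.-1%:R ^+ k.-1).
Proof.
have k1_gt0 : (0 < k.-1)%N by rewrite -subn1 subn_gt0.
have natr_neq0 q : (0 < q)%N -> q%:R != 0 :> F by rewrite pnatr_eq0 -lt0n.
have outE u : outdeg m u = (rootdeg f u * k.-1)%N.
  exact: (outdeg_arc_count _ _ _ _ _ E_unif _ star_rooted).
rewrite (mcoeff_trace F n m b) ?outE ?star_total_center ?muln_gt0 ?w_gt0 //; last first.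
  exact: star_balanced.
rewrite det_star natr_prod mulrA mulrCA -!mulrA; congr (_ * _); rewrite !mulrA.
rewrite /weight -big_split /=.
(* The vertex factor of [weight] times that of the BEST theorem: (d(k-1))! cancels down to d(k-1).
   For d = 0 all factors are 1, the predecessor of 0 being 0. *)
pose g u : F := if rootdeg f u == 0%N then 1 else
  (rootdeg f u).-1`!%:R / (k.-1%:R * \prod_e (f u e)`!%:R).
have gE u : (rootdeg f u)`!%:R / (rootdeg f u * k.-1)`!%:R *
    (\prod_e (f u e)`!%:R^-1) * (outdeg m u).-1`!%:R = g u.
  rewrite outE /g; case: posnP => [d0 | d_gt0].
    rewrite d0 mul0n fact0 divff ?oner_neq0 // mul1r mulr1 big1 // => e _.
    move: d0; rewrite /rootdeg => /eqP; rewrite sum_nat_eq0 => /forallP/(_ e) /=.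
    by move/eqP->; rewrite fact0 invr1.
  have dk_gt0 : (0 < rootdeg f u * k.-1)%N by rewrite muln_gt0 d_gt0.
  rewrite prodfV -{1}(prednK d_gt0) -{1}(prednK dk_gt0) !factS !prednK // !natrM.
  field; apply/and4P; split; rewrite ?natr_neq0 ?fact_gt0 //.
  by rewrite -natr_prod natr_neq0 // prodn_gt0 // => e; rewrite fact_gt0.
rewrite (eq_bigr g) => [|u _]; last by rewrite mulrC gE.
have rooted_b e : f b e = w e :> nat.
  by rewrite fE; case: ifPn => // bE; case: (posnP (w e)) => // /center; rewrite (negPf bE).
rewrite (bigD1 b) //= -mulrA; congr (_ * _).
  rewrite /g star_total_center gtn_eqF //; congr (_ / (_ * _)).
  by apply: eq_bigr => e _; rewrite rooted_b.
rewrite (eq_bigr (fun u => \prod_(e | (0 < w e)%N)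
   (if u \in E e then (k.-1 * w e)%:R^-1 else 1 : F))) => [|u ub]; last first.
  rewrite /g; have [[e we uE] | uE] := starP u; last first.
    by rewrite star_total0 //= big1 // => e /uE/negPf ->.
  rewrite (star_total u e) // gtn_eqF // (star_factor _ u e) //.
  rewrite (bigD1 e) //= big1 => [|e' e'e]; last by rewrite (star_other u e).
  rewrite fE uE mulr1 -{2}(prednK we) factS prednK // !natrM.
  by field; rewrite !natr_neq0 // fact_gt0.
(* For each used edge, the k-1 factors 1/((k-1) w_e) meet (k w_e)^(k-1)/k from the determinant, and
   w_e cancels. *)
rewrite star_prod -big_split; apply: eq_bigr => e we /=.
rewrite !natrM exprVn !exprMn.
have -> : k%:R ^+ k.-1 = k%:R * k%:R ^+ k.-2 :> F by rewrite -exprS prednK.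
have : k.-1%:R ^+ k.-1 != 0 :> F by rewrite expf_neq0 ?natr_neq0.
have : (w e)%:R ^+ k.-1 != 0 :> F by rewrite expf_neq0 ?natr_neq0.
move: (_ ^+ k.-1) (_ ^+ k.-1) (_ ^+ k.-2) => x y z x0 y0; field.
by rewrite x0 y0 natr_neq0.
Qed.

End Star.

(** * Two edges *)

Section TwoEdges.
Variables (F : numFieldType) (k n r : nat) (E : 'I_r -> {set 'I_n}).
Hypothesis k_gt1 : (1 < k)%N.
Hypothesis E_unif : forall e, #|E e| = k.
Implicit Types (x : 'I_r * 'I_r) (e : 'I_r) (u b : 'I_n).
Let k_gt0 : (0 < k)%N := ltnW k_gt1.

Definition pair_weight x e : nat := ((e == x.1) + (e == x.2))%N.

(** The values are at most 2, hence within the bound [2 * k], and [inord] never takes its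
    default. *)
Definition pair_count x : {ffun 'I_n -> {ffun 'I_r -> 'I_(2 * k).+1}} :=
  [ffun u => [ffun e => inord (if u \in E e then pair_weight x e else 0)]].

Definition trace_term (f : {ffun 'I_n -> {ffun 'I_r -> 'I_(2 * k).+1}}) : F :=
  weight F k f * ((\tr (generic_mx F n ^+ (2 * k * k.-1)))@_(arc_count E f) *
                  (mfact (arc_count E f))%:R).

Lemma pair_countE x u e :
  pair_count x u e = (if u \in E e then pair_weight x e else 0%N) :> nat.
Proof.
rewrite !ffunE inordK // ltnS /pair_weight; case: ifP => // _.
by apply: (@leq_trans 2%N); [case: (_ == _); case: (_ == _) | rewrite leq_pmulr].
Qed.

Lemma sum_pair_weight x : (\sum_e pair_weight x e = 2)%N.
Proof.
rewrite big_split /= (bigD1 x.1) //= eqxx big1 => [|e /negPf -> //].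
by rewrite (bigD1 x.2) //= eqxx big1 // => e /negPf ->.
Qed.

Lemma pair_count_rooted x : rooted E (pair_count x).
Proof.
apply/forallP => u; apply/forallP => e; apply/implyP.
by rewrite pair_countE; case: ifP.
Qed.

Lemma sum_rootdeg_pair_count x : (\sum_u rootdeg (pair_count x) u = 2 * k)%N.
Proof.
transitivity ((\sum_e pair_weight x e) * k)%N; last by rewrite sum_pair_weight.
rewrite /rootdeg exchange_big /= big_distrl /=.
apply: eq_bigr => e _; rewrite (eq_bigr _ (fun u _ => pair_countE x u e)).
by rewrite -big_mkcond sum_nat_const E_unif mulnC.
Qed.

Lemma mdeg_pair_count x : (mdeg (arc_count E (pair_count x)) = 2 * k * k.-1)%N.
Proof.
rewrite (mdeg_arc_count _ _ _ _ E_unif) ?pair_count_rooted //.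
by rewrite -big_distrl sum_rootdeg_pair_count.
Qed.

Lemma pair_weight_gt0 x e : (0 < pair_weight x e)%N -> e = x.1 \/ e = x.2.
Proof. by rewrite /pair_weight; do 2![case: eqP; [by auto |]]. Qed.

Lemma trace_term_pair x b : b \in E x.1 -> b \in E x.2 ->
  (x.1 = x.2 \/ E x.1 :&: E x.2 = [set b]) ->
  trace_term (pair_count x) =
  (2 * k)%:R / \prod_e (pair_weight x e)`!%:R *
  \prod_(e | (0 < pair_weight x e)%N) (k%:R ^+ k.-2 / k.-1%:R ^+ k.-1).
Proof.
move=> b1 b2 x12; rewrite /trace_term -(mdeg_pair_count x).
rewrite (star_term F k n r (2 * k) E k_gt1 E_unif (pair_weight x) b) //.
- rewrite sum_pair_weight mdeg_pair_count factS fact0 natrM.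
  have k1 : k.-1%:R != 0 :> F by rewrite pnatr_eq0 -lt0n -subn1 subn_gt0.
  congr (_ * _); rewrite invfM mul1r -mulrA; congr (_ * _).
  by rewrite mulrA divff // mul1r.
- exact: pair_countE.
- by rewrite sum_pair_weight.
- by move=> e /pair_weight_gt0[] ->.
move=> e e' u /pair_weight_gt0 e12 /pair_weight_gt0 e'12 ue ue' ee'.
case: x12 => [x12 | /setP /(_ u)].
  by move: ee' e12 e'12; rewrite x12 => /eqP ee' [] ? [] ?; case: ee'; congruence.
rewrite !inE => u12; apply/eqP; rewrite -u12.
by case: e12 ue ee' => -> ue; case: e'12 ue' => -> ue'; rewrite ?eqxx ?ue ?ue'.
Qed.

Lemma trace_term_single e :
  trace_term (pair_count (e, e)) = k%:R ^+ k.-1 / k.-1%:R ^+ k.-1.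
Proof.
(* With a single used edge, any of its vertices serves as centre. *)
have [b bE] : exists b, b \in E e by apply/card_gt0P; rewrite E_unif.
rewrite (trace_term_pair (e, e) b) //=; last by left.
have wE e' : pair_weight (e, e) e' = if e' == e then 2%N else 0%N.
  by rewrite /pair_weight /=; case: eqP.
rewrite (bigD1 e) //= wE eqxx big1 => [|e' /negPf e'e]; last by rewrite wE e'e.
rewrite (big_pred1 e) => [|e']; last by rewrite /= wE; case: eqP.
have -> : k%:R ^+ k.-1 = k%:R * k%:R ^+ k.-2 :> F.
  by rewrite -exprS prednK // -subn1 subn_gt0.
rewrite natrM mulr1 (_ : 2`! = 2)%N //; have : k.-1%:R ^+ k.-1 != 0 :> F.
  by rewrite expf_neq0 // pnatr_eq0 -lt0n -subn1 subn_gt0.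
by move: (_ ^+ k.-1) (_ ^+ k.-2) => x y x0; field.
Qed.

Lemma trace_term_meeting e e' b : e != e' -> E e :&: E e' = [set b] ->
  trace_term (pair_count (e, e')) =
  2%:R * k%:R * (k%:R ^+ k.-2 / k.-1%:R ^+ k.-1) ^+ 2.
Proof.
move=> ee' meet_b; have : b \in E e :&: E e' by rewrite meet_b set11.
rewrite inE => /andP[b1 b2]; rewrite (trace_term_pair (e, e') b) //=; last by right.
have wE d : pair_weight (e, e') d = (d == e) || (d == e') :> nat.
  rewrite /pair_weight /=; case: (eqVneq d e) => [->|_]; last by case: eqP.
  by rewrite (negPf ee').
rewrite [X in _ / X]big1 => [|d _]; last by rewrite wE; case: orb.
rewrite divr1 natrM; congr (_ * _).
rewrite (bigD1 e) /=; last by rewrite wE eqxx.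
rewrite (big_pred1 e') => [|d]; first by rewrite expr2.
rewrite /= wE; case: (eqVneq d e) => [->|_] /=; first by rewrite (negPf ee').
by case: (d == e').
Qed.

(** No arc joins the two edges, so [E e'] is a closed set avoiding a root in [E e] and the reduced
    Laplacian is singular. In the unbalanced case the trace coefficient is already 0. *)
Lemma trace_term_disjoint e e' : [disjoint E e & E e'] ->
  trace_term (pair_count (e, e')) = 0.
Proof.
move=> dis; set m := arc_count E (pair_count (e, e')).
have inP d u : (0 < pair_count (e, e') u d)%N -> u \in E d /\ (d = e \/ d = e').
  rewrite pair_countE; case: ifP => // uE /pair_weight_gt0 /=; by [].
have [b bE] : exists b, b \in E e by apply/card_gt0P; rewrite E_unif.
have [z zE] : exists z, z \in E e' by apply/card_gt0P; rewrite E_unif.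
have outE u : outdeg m u = (rootdeg (pair_count (e, e')) u * k.-1)%N.
  by apply: outdeg_arc_count => //; apply: pair_count_rooted.
have out_gt0 u d : u \in E d -> d = e \/ d = e' -> (0 < outdeg m u)%N.
  move=> uE de; rewrite outE muln_gt0 -subn1 subn_gt0 k_gt1 andbT.
  rewrite /rootdeg (bigD1 d) //= pair_countE uE /pair_weight /= ltn_addr //.
  by case: de => ->; rewrite eqxx ?addn1.
have notin u : u \in E e' -> u \notin E e.
  by move=> uE'; apply/negP => uE; move/pred0P: dis => /(_ u) /=; rewrite uE uE'.
have [bal | nbal] := boolP [forall u, outdeg m u == indeg m u]; last first.
  rewrite /trace_term (_ : mcoeff _ _ = 0) ?mul0r ?mulr0 //.
  apply: contraNeq nbal => /mcoeff_trace_supp[_ bal].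
  by apply/forallP => u; rewrite bal.
rewrite /trace_term -(mdeg_pair_count (e, e')) -/m.
rewrite (mcoeff_trace F n m b); first last.
- by apply: (out_gt0 b e) => //; left.
- by move=> u; apply/eqP; exact: (forallP bal).
rewrite (det_laplacian_closed F n b m (E e') z) ?mulr0 //.
- by apply: contraL bE => /notin.
- by move=> u uE; rewrite -lt0n (out_gt0 u e') //; right.
move=> u v; rewrite /m arcs_arc_count sum_nat_eq0 negb_forall => /existsP[d] /=.
rewrite muln_eq0 negb_or -lt0n => /andP[/inP[ud de] ].
rewrite eqb0 negbK !inE => /andP[_ vd].
case: de ud vd => -> ud vd; last by rewrite ud vd.
by rewrite (negPf (contraL (notin u) ud)) (negPf (contraL (notin v) vd)).
Qed.

End TwoEdges.

(** * The hypercycle of length four *)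

Section FourCycle.
Variable k : nat.
Hypothesis k_ge3 : (3 <= k)%N.
Let n := (4 * k.-1)%N.
Let E : 'I_4 -> {set 'I_n} := @hypercycle_edge 4 k.
Implicit Types (e d : 'I_4) (u v : 'I_n).
Let k1_gt1 : (1 < k.-1)%N. Proof. by rewrite -subn1 ltn_subRL. Qed.
Let k1_gt0 : (0 < k.-1)%N := ltnW k1_gt1.

(** An edge is a block of [k.-1] consecutive vertices plus the first vertex of the next block,
    cyclically. *)
Lemma hypercycle_edgeP e v :
  (v \in E e) = (v %/ k.-1 == e :> nat)%N || (v == ordS e * k.-1 :> nat)%N.
Proof.
rewrite inE; apply/existsP/orP => [[t /eqP vt] | ].
  have [t_lt | t_ge] := ltnP t k.-1.
    left; rewrite vt modn_small; last first.
      apply: (@leq_trans (e.+1 * k.-1)%N); first by rewrite mulSn addnC ltn_add2r.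
      by rewrite leq_pmul2r.
    by rewrite divnMDl // divn_small ?addn0.
  right; have tE : t = k.-1 :> nat by have := ltn_ord t; lia.
  by rewrite vt tE /= -mulSnr muln_modl.
case=> [/eqP vE | /eqP vE].
  have t_lt : (v %% k.-1 < k)%N by rewrite (leq_trans (ltn_pmod _ k1_gt0)) ?leq_pred.
  exists (Ordinal t_lt) => /=; rewrite -vE -divn_eq modn_small //.
have t_lt : (k.-1 < k)%N by rewrite prednK // (leq_trans _ k_ge3).
by exists (Ordinal t_lt); rewrite vE /= -mulSnr muln_modl.
Qed.

Lemma vertex_proof e (t : nat) : (t < k.-1)%N -> (e * k.-1 + t < n)%N.
Proof.
move=> t_lt; apply: (@leq_trans (e.+1 * k.-1)%N); last by rewrite leq_pmul2r.
by rewrite mulSn addnC ltn_add2r.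
Qed.

(** The first vertex of [e] is shared with the preceding edge. The second one, [core e], lies on no
    other edge, which is where k >= 3 enters. *)
Definition joint e : 'I_n := Ordinal (vertex_proof e 0 k1_gt0).
Definition core e : 'I_n := Ordinal (vertex_proof e 1 k1_gt1).

Lemma joint_in e d : (joint e \in E d) = (d == e) || (e == ordS d).
Proof.
rewrite hypercycle_edgeP /= addn0 mulnK // eqn_pmul2r //.
by rewrite [d == e]eq_sym.
Qed.

Lemma edge_joint_or_core e v : v \in E e ->
  [\/ v = joint e, v = joint (ordS e) | forall d, v \in E d -> d = e].
Proof.
rewrite hypercycle_edgeP => /orP[/eqP ve | /eqP ve]; last first.
  by apply: Or32; apply: val_inj; rewrite /= addn0.
have [vj | vj] := eqVneq v (joint e); first exact: Or31.
apply: Or33 => d; rewrite hypercycle_edgeP ve => /orP[/eqP ed | /eqP vd].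
  exact/esym/val_inj.
case/eqP: vj; apply: val_inj; rewrite /= addn0 -ve vd mulnK //.
Qed.

Lemma core_in e d : (core e \in E d) = (d == e).
Proof.
rewrite hypercycle_edgeP /= divnMDl // divn_small // addn0 [d == e]eq_sym -val_eqE /=.
case: (_ == _ :> nat)%N => //=; apply/eqP => /(congr1 (modn^~ k.-1)).
by rewrite modnMDl modnMl modn_small.
Qed.

Lemma edge_inj : injective E.
Proof. by move=> e d Eed; have := core_in e e; rewrite Eed core_in eqxx => /eqP. Qed.

Lemma edge_card e : #|E e| = k.
Proof.
apply: (@hypercycle_uniform 4 k) => //; first exact: (leq_trans _ k_ge3).
exact: imset_f.
Qed.

Lemma ordS4_neq e : ordS e != e. Proof. by case: e => [[|[|[|[|]]]]]. Qed.

Lemma edge_meet e : E e :&: E (ordS e) = [set joint (ordS e)].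
Proof.
apply/setP => v; rewrite in_setI in_set1; apply/andP/eqP => [[ve vSe] | ->]; last first.
  by rewrite !joint_in !eqxx orbT.
have [vj | // | /(_ _ vSe) /eqP] := edge_joint_or_core e v ve; last first.
  by rewrite (negPf (ordS4_neq e)).
by move: vSe; rewrite vj joint_in; case: e {ve vj} => [[|[|[|[|]]]]].
Qed.

Lemma edge_disjoint e : [disjoint E e & E (ordS (ordS e))].
Proof.
apply/pred0P => v /=; apply/andP => -[ve vSe].
have [vj | vj | /(_ _ vSe) /eqP] := edge_joint_or_core e v ve.
- by move: vSe; rewrite vj joint_in; case: e {ve vj} => [[|[|[|[|]]]]].
- by move: vSe; rewrite vj joint_in; case: e {ve vj} => [[|[|[|[|]]]]].
by case: e {ve vSe} => [[|[|[|[|]]]]].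
Qed.

(** * Balanced choices of roots on the four-cycle *)

Section Balanced.
Variable f : {ffun 'I_n -> {ffun 'I_4 -> 'I_(2 * k).+1}}.
Hypothesis rf : rooted E f.
Hypothesis total_f : (\sum_u rootdeg f u = 2 * k)%N.
Hypothesis bal : outdeg (arc_count E f) =1 indeg (arc_count E f).
Let w e := f (core e) e : nat.
Let s e := (\sum_u f u e)%N.

Lemma notin_count u e : u \notin E e -> f u e = 0%N :> nat.
Proof. exact: rooted_eq0 rf u e. Qed.

Lemma vertex_balance u : (k * rootdeg f u = \sum_(e | u \in E e) s e)%N.
Proof.
have k_gt0 : (0 < k)%N by apply: leq_trans k_ge3.
exact: (proj1 (arc_count_balanced _ _ _ _ _ k_gt0 edge_card f rf) bal u).
Qed.

(** A vertex on one edge only can be a root of that edge only, so its balance equation has a single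
    term on each side. *)
Lemma core_balance e v : v \in E e -> (forall d, v \in E d -> d = e) ->
  (k * f v e = s e)%N.
Proof.
move=> ve only; have := vertex_balance v; rewrite /rootdeg (bigD1 e) //= big1 ?addn0.
  move->; rewrite (big_pred1 e) // => d /=.
  by apply/idP/eqP => [/only | ->].
by move=> d de; apply: notin_count; apply: contraNN de => /only ->.
Qed.

Lemma edge_total_core e : s e = (k * w e)%N.
Proof.
rewrite (core_balance e (core e)) ?core_in // => d.
by rewrite core_in => /eqP.
Qed.

Lemma core_count e v : v \in E e -> (forall d, v \in E d -> d = e) -> f v e = w e :> nat.
Proof.
move=> ve only; have := core_balance e v ve only; rewrite edge_total_core => /eqP.
by rewrite eqn_pmul2l ?(leq_trans _ k_ge3) // => /eqP.
Qed.

Lemma sum_core_counts : (\sum_e w e = 2)%N.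
Proof.
apply/eqP; rewrite -(eqn_pmul2l (_ : 0 < k)%N) ?(leq_trans _ k_ge3) //.
rewrite big_distrr /= [X in _ == X]mulnC -total_f /rootdeg exchange_big /=.
by apply/eqP/eq_bigr => e _; rewrite -edge_total_core.
Qed.

(** Of the total k w_e of the edge, its k-2 inner vertices take w_e each, leaving 2 w_e for the two
    joints. *)
Lemma joint_edge e : (f (joint e) e + f (joint (ordS e)) e = 2 * w e)%N.
Proof.
have := edge_total_core e; rewrite /s (bigID (mem (E e))) /= [X in (_ + X)%N]big1 ?addn0; last first.
  by move=> u; exact: notin_count.
have je : joint e \in E e by rewrite joint_in eqxx.
have jSe : joint (ordS e) \in E e by rewrite joint_in eqxx orbT.
have jne : joint (ordS e) != joint e.
  apply: contra (ordS4_neq e) => /eqP /(congr1 val) /=; rewrite !addn0 => /eqP.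
  by rewrite eqn_pmul2r.
rewrite (bigD1 (joint e)) //= (bigD1 (joint (ordS e))) /= ?jSe ?jne //.
rewrite (eq_bigr (fun=> w e)) => [|v /andP[/andP[ve vj] vjS]]; last first.
  apply: core_count => //.
  have [/eqP | /eqP | //] := edge_joint_or_core e v ve.
    by rewrite (negPf vj).
  by rewrite (negPf vjS).
rewrite sum_nat_const; set c := #|_|.
have cE : (c.+2 = k)%N.
  rewrite -[RHS](edge_card e) (cardsD1 (joint e)) je (cardsD1 (joint (ordS e))).
  rewrite in_setD1 jSe jne /= !add1n; congr _.+2; rewrite /c -sum1_card -[RHS]sum1_card.
  apply: eq_bigl => v; rewrite !in_setD1 unfold_in.
  by rewrite andbC [X in _ && X = _]andbC.
have -> : (k * w e = c * w e + 2 * w e)%N by rewrite -mulnDl addn2 cE.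
by lia.
Qed.

Lemma joint_vertex e :
  (f (joint (ordS e)) (ordS e) + f (joint (ordS e)) e = w (ordS e) + w e)%N.
Proof.
have := vertex_balance (joint (ordS e)); rewrite /rootdeg.
have ne := ordS4_neq e; have ne' := ne; rewrite eq_sym in ne'.
have only d : joint (ordS e) \in E d -> d != ordS e -> d = e.
  rewrite joint_in => /orP[/eqP -> | /eqP /ordS_inj -> //].
  by rewrite eqxx.
rewrite (bigD1 (ordS e)) //= (bigD1 e) //= big1 ?addn0; last first.
  move=> d /andP[dS de]; apply: notin_count; apply: contra de => jd.
  by apply/eqP/only.
rewrite (bigD1 (ordS e)) ?joint_in ?eqxx //= (big_pred1 e) => [|d /=]; last first.
  apply/andP/eqP => [[jd dS] | ->]; first exact: only.
  by rewrite joint_in eqxx orbT.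
rewrite !edge_total_core -mulnDr => /eqP.
by rewrite eqn_pmul2l ?(leq_trans _ k_ge3) // => /eqP.
Qed.

(** Subtracting the equations of [joint_edge] and [joint_vertex] shows that the deviation of
    [f (joint e) e] from [w e] is the same for all four edges. The weights sum to 2, so some edge
    has weight 0; both its joint counts vanish, and so does the deviation. *)
Lemma joint_values e : f (joint e) e = w e :> nat /\ f (joint (ordS e)) e = w e :> nat.
Proof.
pose a d : nat := f (joint d) d.
pose i0 : 'I_4 := @Ordinal 4 0 isT; pose i1 := ordS i0; pose i2 := ordS i1.
pose i3 := ordS i2; have S3 : ordS i3 = i0 by apply: val_inj.
have sumE : (w i0 + w i1 + w i2 + w i3 = 2)%N.
  rewrite -sum_core_counts !big_ord_recr big_ord0 /= add0n.
  by congr (w _ + w _ + w _ + w _)%N; apply: val_inj.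
have := joint_vertex i3; rewrite S3.
move: (joint_vertex i0) (joint_vertex i1) (joint_vertex i2).
rewrite -![ordS i0]/i1 -![ordS i1]/i2 -![ordS i2]/i3.
move: (joint_edge i0) (joint_edge i1) (joint_edge i2) (joint_edge i3).
rewrite -![ordS i0]/i1 -![ordS i1]/i2 -![ordS i2]/i3 S3 => e0 e1 e2 e3 v0 v1 v2 v3.
have a_w : [/\ a i0 = w i0, a i1 = w i1, a i2 = w i2 & a i3 = w i3].
  by rewrite /a; split; lia.
have [a0 a1 a2 a3] := a_w.
suff aE : a e = w e.
  by split=> //; have := joint_edge e; rewrite -/(a e) aE; lia.
have : e \in [:: i0; i1; i2; i3] by case: (e) => [[|[|[|[|]]]]].
by rewrite !inE => /or4P[] /eqP ->.
Qed.

Lemma balanced_weights u e : f u e = (if u \in E e then w e else 0%N) :> nat.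
Proof.
have [ue | ] := boolP (u \in E e); last exact: notin_count.
have [je jSe] := joint_values e.
by have [-> | -> | only] := edge_joint_or_core e u ue; last exact: core_count.
Qed.

(** Weights with sum 2 form a multiset of two edges; the condition on [x] selects one ordering of
    it. *)
Lemma balanced_pair : exists2 x : 'I_4 * 'I_4, (x.1 <= x.2)%N & f = pair_count k n 4 E x.
Proof.
have [x x12 wx] : exists2 x : 'I_4 * 'I_4, (x.1 <= x.2)%N &
    forall e, w e = pair_weight 4 x e.
  have [e we] : exists e, (0 < w e)%N.
    apply/existsP; apply: contraT => /existsPn z; have := sum_core_counts.
    by rewrite big1 // => e _; apply/eqP; rewrite -leqn0 leqNgt.
  have [e' we'] : exists e', (0 < w e' - (e' == e))%N.
    apply/existsP; apply: contraT => /existsPn z; have := sum_core_counts.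
    rewrite (bigD1 e) //= big1 => [|d /negPf de].
      by have := z e; rewrite eqxx -leqNgt; lia.
    by have := z d; rewrite de; lia.
  have wE d : w d = pair_weight 4 (e, e') d.
    (* The pair weight is bounded by [w] pointwise and both sum to 2, hence they agree. *)
    have le_w d' : (pair_weight 4 (e, e') d' <= w d')%N.
      rewrite /pair_weight /=; case: (eqVneq d' e) => [->|de].
        case: (eqVneq e e') => [ee'|]; last by rewrite addn0.
        by move: we'; rewrite -ee' eqxx; lia.
      by case: (eqVneq d' e') => [d'e'|//]; move: we'; rewrite -d'e' (negPf de); lia.
    have := etrans (sum_pair_weight 4 (e, e')) (esym sum_core_counts).
    rewrite (bigD1 d) //= [in RHS](bigD1 d) //=.
    have : (\sum_(d' | d' != d) pair_weight 4 (e, e') d' <=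
            \sum_(d' | d' != d) w d')%N by apply: leq_sum.
    move=> le_rest eq_sum; apply/eqP; rewrite eqn_leq le_w andbT.
    by rewrite -(leq_add2r (\sum_(i < 4 | i != d) w i)) -eq_sum leq_add2l.
  have [ee' | e'e] := leqP e e'; first by exists (e, e').
  by exists (e', e) => [|d]; [exact: ltnW | rewrite wE /pair_weight addnC].
exists x => //; apply/ffunP => u; apply/ffunP => e; apply: val_inj.
apply: etrans (balanced_weights u e) _; rewrite wx.
by apply: esym; apply: pair_countE; apply: ltnW.
Qed.

End Balanced.

Let k_gt1 : (1 < k)%N := ltnW k_ge3.

(** The weight of each edge is read off at its core vertex, and the weights determine the ordered
    pair. *)
Lemma pair_count_inj (x y : 'I_4 * 'I_4) : (x.1 <= x.2)%N -> (y.1 <= y.2)%N ->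
  pair_count k n 4 E x = pair_count k n 4 E y -> x = y.
Proof.
move=> x12 y12 xy.
have wE e : pair_weight 4 x e = pair_weight 4 y e.
  have := pair_countE k n 4 E k_gt1 x (core e) e.
  by rewrite xy pair_countE // core_in eqxx.
case: x y x12 y12 {xy} wE => [a b] [c d] /= ab cd wE.
have := (wE a, wE b, wE c, wE d); rewrite /pair_weight /= !eqxx.
rewrite -!val_eqE /= => wN.
have [ac bd] : a = c :> nat /\ b = d :> nat by move: wN => [[[wa wb] wc] wd]; lia.
by congr (_, _); apply: val_inj.
Qed.

(** * Summation over the pairs of edges *)

Variable F : numFieldType.

(** A choice that does not come from a pair is unbalanced, so its trace coefficient vanishes. *)
Lemma sum_trace_term :
  \sum_(f : {ffun 'I_n -> {ffun 'I_4 -> 'I_(2 * k).+1}} |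
         (\sum_u rootdeg f u == 2 * k)%N && rooted E f) trace_term F k n 4 E f =
  \sum_(x : 'I_4 * 'I_4 | (x.1 <= x.2)%N) trace_term F k n 4 E (pair_count k n 4 E x).
Proof.
pose A := [set x : 'I_4 * 'I_4 | (x.1 <= x.2)%N].
rewrite (bigID (mem (pair_count k n 4 E @: A))) /= [X in _ + X]big1 ?addr0; last first.
  move=> f /andP[/andP[/eqP total_f rf] fA].
  rewrite /trace_term (_ : mcoeff _ _ = 0) ?mul0r ?mulr0 //.
  apply: contraNeq fA => /mcoeff_trace_supp[_ bal].
  by have [x x12 ->] := balanced_pair f rf total_f bal; rewrite imset_f // inE.
rewrite (eq_bigl (fun f => f \in pair_count k n 4 E @: A)) => [|f]; last first.
  case: (boolP (f \in _)) => [/imsetP[x _ ->] | _]; last by rewrite andbF.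
  rewrite (sum_rootdeg_pair_count k n 4 E k_gt1 edge_card) eqxx andbT.
  exact: (pair_count_rooted k n 4 E k_gt1).
rewrite big_imset /= => [|x y]; last by rewrite !inE; exact: pair_count_inj.
by apply: eq_bigl => x; rewrite inE.
Qed.

Lemma trace_term_pairE e e' : trace_term F k n 4 E (pair_count k n 4 E (e, e')) =
  if e == e' then k%:R ^+ k.-1 / k.-1%:R ^+ k.-1
  else if (e' == ordS e) || (e == ordS e') then
    2%:R * k%:R * (k%:R ^+ k.-2 / k.-1%:R ^+ k.-1) ^+ 2
  else 0.
Proof.
case: eqVneq => [<- | ee']; first exact: (trace_term_single F k n 4 E k_gt1 edge_card).
case: eqVneq => [e'S | e'S] /=.
  apply: (trace_term_meeting F k n 4 E k_gt1 edge_card _ _ (joint (ordS e))) => //.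
  by rewrite e'S edge_meet.
case: eqVneq => [eS | eS] /=.
  apply: (trace_term_meeting F k n 4 E k_gt1 edge_card _ _ (joint (ordS e'))) => //.
  by rewrite eS setIC edge_meet.
apply: (trace_term_disjoint F k n 4 E k_gt1 edge_card).
(* On a cycle of length four, distinct edges that are not adjacent are opposite. *)
have -> : e' = ordS (ordS e).
  apply/eqP; move: ee' e'S eS.
  by case: e => [[|[|[|[|]]]] ?] //; case: e' => [[|[|[|[|]]]] ?].
exact: edge_disjoint.
Qed.

(** Of the ten unordered pairs, four repeat an edge, four are adjacent and two are opposite; the
    factor 2 in each adjacent term gives the 8. *)
Lemma sum_trace_term_pair :
  \sum_(x : 'I_4 * 'I_4 | (x.1 <= x.2)%N) trace_term F k n 4 E (pair_count k n 4 E x) =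
  4 * (k%:R ^+ k.-1 / k.-1%:R ^+ k.-1) +
  8 * (k%:R * (k%:R ^+ k.-2 / k.-1%:R ^+ k.-1) ^+ 2).
Proof.
rewrite -(pair_big_dep xpredT (fun e e' : 'I_4 => (e <= e')%N)
  (fun e e' => trace_term F k n 4 E (pair_count k n 4 E (e, e')))) /=.
under eq_bigr => e _.
  rewrite big_mkcond; under eq_bigr => e' _ do rewrite trace_term_pairE.
  over.
rewrite !big_ord_recr !big_ord0 /=.
set S := _ / _; set M := (_ / _) ^+ 2; ring.
Qed.

End FourCycle.

Theorem theorem3p2 (C : numClosedFieldType) (k : nat) (hk : (3 <= k)%N) :
  tensor_trace (2 * k) (adjacency_tensor C k (hypercycle 4 k)) =
  (4 * k%:R ^+ (k - 1) * (k%:R - 1) ^+ (3 * k - 4) +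
   8 * k%:R ^+ (2 * k - 3) * (k%:R - 1) ^+ (2 * k - 3))%:MP.
Proof.
have k_gt0 : (0 < k)%N by apply: leq_trans hk.
rewrite (adjacency_traceE C k (4 * k.-1) 4 (hypercycle_edge k) k_gt0
  (edge_inj k hk) (edge_card k hk) (2 * k)).
rewrite (sum_trace_term k hk C) (sum_trace_term_pair k hk C); congr (_%:MP).
have k1E : k.-1%:R = k%:R - 1 :> C by rewrite -{2}(prednK k_gt0) -natr1 addrK.
have k1_neq0 : k%:R - 1 != 0 :> C by rewrite -k1E pnatr_eq0; lia.
rewrite natrX k1E; set K := k%:R; set P := K - 1.
have -> : (k - 1 = k.-1)%N by lia.
(* The exponent n-1 is 4k-5 = (3k-4) + (k-1) = (2k-3) + 2(k-1), so the prefactor absorbs the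
   denominators for one or two used edges. *)
have -> : ((4 * k.-1).-1 = 3 * k - 4 + k.-1)%N by lia.
have PE : P ^+ (3 * k - 4) * P ^+ k.-1 = P ^+ (2 * k - 3) * P ^+ k.-1 * P ^+ k.-1.
  by rewrite -!exprD; congr (_ ^+ _); lia.
have -> : K ^+ (2 * k - 3) = K * K ^+ k.-2 * K ^+ k.-2.
  by rewrite -exprS -exprD; congr (_ ^+ _); lia.
have := expf_neq0 k.-1 k1_neq0; rewrite -/P => Pk.
rewrite exprD mulrDr [in X in _ + X]PE.
by move: (P ^+ k.-1) (K ^+ k.-1) (K ^+ k.-2) Pk => a b c a0; field.
Qed.
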